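(* If $G$ is a planar graph with $(4,2)$-list assignment $L$ and $G$ contains no offensive triangles (that is, no triangle $T\subseteq G$ satisfies $\left|\bigcap_{v\in V(T)}L(v)\right|=2$), then $G$ is $L$-colourable.
   Context: Graphs are finite and simple. A $k$-list assignment $L$ for a graph $G$ is a function that assigns to each vertex $v\in V(G)$ a list (set) $L(v)$ of at least $k$ colours. An $L$-colouring of $G$ is a proper colouring $\phi$ of $G$ (adjacent vertices receive distinct colours) with $\phi(v)\in L(v)$ for all $v\in V(G)$; $G$ is $L$-colourable if it admits an $L$-colouring. For positive integers $\ell,k$, an $(\ell,k)$-list assignment for $G$ is an $\ell$-list assignment $L$ such that $|L(u)\cap L(v)|\leq k$ for each edge $uv\in E(G)$. Given a graph $G$ with list assignment $L$, an offensive triangle is a triangle $T\subseteq G$ with $\left|\bigcap_{v\in V(T)}L(v)\right|=2$. *)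

(* Defs.v *)
From HB Require Import structures.
From mathcomp Require Import all_boot all_order all_algebra.
From mathcomp Require Import all_classical all_reals all_analysis.
Import Order.TTheory GRing.Theory Num.Theory numFieldNormedType.Exports.

Set Implicit Arguments.
Unset Strict Implicit.
Unset Printing Implicit Defensive.

Local Open Scope classical_set_scope.
Local Open Scope ring_scope.
Local Open Scope card_scope.

Record sgraph := SGraph {
  vertex :> finType;
  adj : rel vertex;
  adj_sym : symmetric adj;
  adj_irrefl : irreflexive adj }.

Definition is_arc (R : realType) (g : R -> R * R) (a b : R * R) : Prop :=
  [/\ {within `[0, 1], continuous g},
      set_inj `[0, 1] g,
      g 0 = a & g 1 = b].

(* A drawing of G in the plane R^2: [p] places the vertices and [g u v]
   parametrizes the edge uv from [p u] to [p v].  Since [adj] lists every edge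
   twice, [g v u] is required to be the same curve traversed backwards. *)
Definition is_plane_drawing (R : realType) (G : sgraph)
    (p : G -> R * R) (g : G -> G -> R -> R * R) : Prop :=
  [/\ injective p,
      forall u v, adj u v -> is_arc (g u v) (p u) (p v),
      forall u v (t : R), adj u v -> 0 <= t <= 1 -> g v u t = g u v (1 - t),
      forall u v w (t : R), adj u v -> 0 < t < 1 -> g u v t <> p w
    & forall u v u' v' (s t : R), adj u v -> adj u' v' ->
        [set u; v]%SET != [set u'; v']%SET ->
        0 < s < 1 -> 0 < t < 1 -> g u v s <> g u' v' t].

Definition planar (R : realType) (G : sgraph) : Prop :=
  exists (p : G -> R * R) (g : G -> G -> R -> R * R), is_plane_drawing p g.

Section ListColouring.
Variables (G : sgraph) (C : Type).
Implicit Type L : G -> set C.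

(* Lists may be infinite, so their sizes are compared with the initial segment
   [`I_n] = {0, ..., n-1} of nat. *)
Definition list_assignment (l : nat) L : Prop :=
  forall v, `I_l #<= L v.

Definition lk_list_assignment (l k : nat) L : Prop :=
  list_assignment l L /\
  (forall u v, adj u v -> L u `&` L v #<= `I_k).

Definition triangle (x y z : G) : Prop := [/\ adj x y, adj y z & adj x z].

Definition offensive_triangle L (x y z : G) : Prop :=
  triangle x y z /\ L x `&` L y `&` L z #= `I_2.

Definition is_list_colouring L (phi : G -> C) : Prop :=
  (forall u v, adj u v -> phi u <> phi v) /\ (forall v, L v (phi v)).

Definition list_colourable L : Prop := exists phi, is_list_colouring L phi.

End ListColouring.

(* Main.v *)
(* The only topological input is that a planar graph has no K5 and no K3,3 minor.
   Arcs of vertex-disjoint edges are disjoint compact sets, so fine samples of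
   them are pairwise separated by horizontal or vertical lines.  For two such
   sampled walks, the parity of what lies above the four end points is then
   determined by the lexicographic order of these end points.  Summing over all
   pairs of disjoint edges of K5 or K3,3, every parity term cancels, whereas an
   odd number of pairs of edges have interleaved end points.

   The colouring is an induction in the style of Thomassen.  A connected set X
   (the part already coloured and contracted) plays the role of the outside of
   the graph W still to be coloured.  The boundary B is the set of vertices of W
   with a neighbour in X; lists have at least 3 colours on B, at least 4
   elsewhere, and two adjacent vertices of B are precoloured.  A boundary vertex
   with a colour that occurs in no list of a boundary neighbour can be coloured
   and moved to X, and separating cliques inside B split the problem.
   Otherwise excluding the two minors forces B to induce a cycle q, p, x, y, ...
   with q and p precoloured.  The lists of x and y then have exactly two common
   colours, one of which is absent from the list of the vertex after y.  Give it
   to y and the other one to x: a common neighbour of x and y loses at most one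
   colour because the triangle is not offensive. *)
From mathcomp Require Import all_boot.
Set Implicit Arguments.
Unset Strict Implicit.
Unset Printing Implicit Defensive.

(** * Excluded minors and induced cycles *)

Section Minors.
Variables (V : finType) (e : rel V).
Implicit Types A B : {set V}.

Definition connected_set A := forall x y, x \in A -> y \in A ->
  exists s, [/\ path e x s, last x s = y & {subset s <= A}].

Definition touching A B := exists x y, [/\ x \in A, y \in B & e x y].

(** This turns an edge of a minor into a walk inside its two branch sets. The walk runs through the
    touching edge, so it is nonempty even if [x] and [y] coincide. *)
Lemma touching_walk A B x y :
    connected_set A -> connected_set B -> touching A B -> x \in A -> y \in B ->
  exists s, [/\ path e x s, last x s = y, s != [::] &
    {subset x :: s <= A :|: B}].
Proof.
move=> cA cB [a [b [aA bB ab]]] xA yB.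
have [s [xs sa sA]] := cA _ _ xA aA; have [t [bt ty tB]] := cB _ _ bB yB.
exists (s ++ b :: t); split.
- by rewrite cat_path xs /= sa ab.
- by rewrite last_cat /= ty.
- by case: (s).
move=> z; rewrite inE mem_cat inE !inE => /or4P[/eqP->|/sA->|/eqP->|/tB->] //.
- by rewrite xA.
- by rewrite bB orbT.
- by rewrite orbT.
Qed.

Definition K5_free := forall A : nat -> {set V},
  (forall i, i < 5 -> (exists x, x \in A i) /\ connected_set (A i)) ->
  (forall i j, i < j < 5 -> [disjoint A i & A j]) ->
  (forall i j, i < j < 5 -> touching (A i) (A j)) -> False.

Definition K33_free := forall A : nat -> {set V},
  (forall i, i < 6 -> (exists x, x \in A i) /\ connected_set (A i)) ->
  (forall i j, i < j < 6 -> [disjoint A i & A j]) ->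
  (forall i j, i < 3 <= j -> j < 6 -> touching (A i) (A j)) -> False.

Hypotheses (e_sym : symmetric e) (e_irr : irreflexive e).

(** Reverse the walk from [r] to [x] and continue with the walk from [r] to [y]. The symmetry of [e]
    makes the reversed walk legitimate. *)
Lemma connected_rooted A r :
    (forall x, x \in A ->
      exists s, [/\ path e r s, last r s = x & {subset s <= A}]) ->
  r \in A -> connected_set A.
Proof.
move=> rP rA x y /rP[s [rs sx sA]] /rP[t [rt ty tA]].
exists (rev (belast r s) ++ t); split.
- rewrite cat_path -sx rev_path (eq_path (e' := e)) ?rs /=; last first.
    by move=> a b; rewrite e_sym.
  case: (s) => //= a s'; rewrite rev_cons last_rcons; exact: rt.
- rewrite last_cat -ty; case: (s) sx => [|a s'] /= sx; first by rewrite sx.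
  by rewrite rev_cons last_rcons.
- move=> z; rewrite mem_cat mem_rev => /orP[|/tA //].
  by move/mem_belast; rewrite inE => /orP[/eqP->|/sA].
Qed.

Lemma connected_path x s : path e x s -> connected_set [set y in x :: s].
Proof.
move=> xs; apply: (@connected_rooted _ x); last by rewrite inE mem_head.
move=> y; rewrite inE => ys; case/splitPl: ys xs => s1 s2 s1y.
rewrite cat_path => /andP[xs1 _]; exists s1; split=> // z zs.
by rewrite !inE mem_cat zs orbT.
Qed.

Lemma connected_set1 x : connected_set [set x].
Proof.
by move=> a b; rewrite !inE => /eqP-> /eqP->; exists [::].
Qed.

Lemma connected_setU1 A x y :
  connected_set A -> y \in A -> e y x -> connected_set (x |: A).
Proof.
move=> cA yA yx; apply: (@connected_rooted _ y); last by rewrite !inE yA orbT.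
move=> z; rewrite !inE => /orP[/eqP->|zA].
  by exists [:: x]; split=> //=; rewrite ?yx // => z'; rewrite !inE => ->.
have [s [ys sz sA]] := cA _ _ yA zA; exists s; split=> // z' /sA.
by rewrite !inE orbC => ->.
Qed.

Lemma no_K5 A B C D E : K5_free ->
    connected_set A -> connected_set B -> connected_set C -> connected_set D ->
    connected_set E ->
    [/\ [disjoint A & B], [disjoint A & C], [disjoint A & D] & [disjoint A & E]] ->
    [/\ [disjoint B & C], [disjoint B & D] & [disjoint B & E]] ->
    [/\ [disjoint C & D], [disjoint C & E] & [disjoint D & E]] ->
    [/\ touching A B, touching A C, touching A D & touching A E] ->
    [/\ touching B C, touching B D & touching B E] ->
    [/\ touching C D, touching C E & touching D E] -> False.
Proof.
move=> K5 cA cB cC cD cE [ab ac ad ae] [bc bd be] [cd ce de].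
move=> [tab tac tad tae] [tbc tbd tbe] [tcd tce tde].
apply: (K5 (nth set0 [:: A; B; C; D; E])).
- have [a [b [aA bB _]]] := tab; have [c [d [cC' dD _]]] := tcd.
  have [_ [x [_ xE _]]] := tde.
  move=> [|[|[|[|[|i]]]]] //= _; split=> //.
  + by exists a.
  + by exists b.
  + by exists c.
  + by exists d.
  + by exists x.
- by move=> i j /andP[]; move: i j => [|[|[|[|[|i]]]]] [|[|[|[|[|j]]]]] //=.
- by move=> i j /andP[]; move: i j => [|[|[|[|[|i]]]]] [|[|[|[|[|j]]]]] //=.
Qed.

Lemma no_K33 A B C D E F : K33_free ->
    connected_set A -> connected_set B -> connected_set C -> connected_set D ->
    connected_set E -> connected_set F ->
    [/\ [disjoint A & B], [disjoint A & C], [disjoint A & D], [disjoint A & E]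
      & [disjoint A & F]] ->
    [/\ [disjoint B & C], [disjoint B & D], [disjoint B & E] & [disjoint B & F]] ->
    [/\ [disjoint C & D], [disjoint C & E] & [disjoint C & F]] ->
    [/\ [disjoint D & E], [disjoint D & F] & [disjoint E & F]] ->
    [/\ touching A D, touching A E & touching A F] ->
    [/\ touching B D, touching B E & touching B F] ->
    [/\ touching C D, touching C E & touching C F] -> False.
Proof.
move=> K33 cA cB cC cD cE cF [ab ac ad ae af] [bc bd be bf] [cd ce cf] [de df ef].
move=> [tad tae taf] [tbd tbe tbf] [tcd tce tcf].
apply: (K33 (nth set0 [:: A; B; C; D; E; F])).
- have [a [d [aA dD _]]] := tad; have [b [x [bB xE _]]] := tbe.
  have [c [y [cC' yF _]]] := tcf.
  move=> [|[|[|[|[|[|i]]]]]] //= _; split=> //.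
  + by exists a.
  + by exists b.
  + by exists c.
  + by exists d.
  + by exists x.
  + by exists y.
- by move=> i j /andP[]; move: i j => [|[|[|[|[|[|i]]]]]] [|[|[|[|[|[|j]]]]]] //=.
- by move=> i j /andP[]; move: i j => [|[|[|i]]] [|[|[|[|[|[|j]]]]]] //=.
Qed.

Definition simple_cycle c := [&& uniq c, cycle e c & 2 < size c].

Lemma simple_cycle_rot i c : simple_cycle (rot i c) = simple_cycle c.
Proof. by rewrite /simple_cycle rot_uniq rot_cycle size_rot. Qed.

(** Take a longest path inside [B]. All neighbours in [B] of its first vertex [x] lie on the path,
    and one of them is not the successor of [x]; it closes a cycle. *)
Lemma exists_cycle (B : {set V}) b : b \in B ->
    (forall x, x \in B -> 1 < #|[set y in B | e x y]|) ->
  exists c, simple_cycle c /\ {subset c <= B}.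
Proof.
move=> bB degB.
pose P n := [exists t : n.-tuple V,
  [&& path e (head b t) (behead t), uniq t & all (mem B) t]].
have P1 : P 1.
  by apply/existsP; exists [tuple b]; rewrite /= bB.
have Pmax n : P n -> n <= #|V|.
  case/existsP => t /and3P[_ ut _]; rewrite -[n](size_tuple t).
  by rewrite -(card_uniqP ut) max_card.
case: (ex_maxnP (ex_intro P 1 P1) Pmax) => n /existsP[t].
case/and3P => tp tu tB nmax.
have [x [s Et]] : exists x s, tval t = x :: s.
  case Et: (tval t) => [|x s]; last by exists x, s.
  by have := nmax 1 P1; rewrite -(size_tuple t) Et.
move: tp tu tB; rewrite Et => /= xs /andP[xs' us] /andP[xB sB].
have nbr_in_s y : y \in B -> e x y -> y \in s.
  move=> yB xy; apply: contraT => ys.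
  have Hs : size (y :: x :: s) == n.+1 by rewrite -[n](size_tuple t) Et.
  have := nmax n.+1; rewrite ltnn; apply.
  apply/existsP; exists (Tuple Hs); rewrite /= e_sym xy xs inE negb_or ys us xs'.
  rewrite xB sB [y \in _]yB !andbT /=.
  by apply: contraTneq xy => ->; rewrite e_irr.
case/card_gt1P: (degB x xB) => y1 [y2 []].
rewrite !inE => /andP[y1B xy1] /andP[y2B xy2] y12.
have [a [s' Es]] : exists a s', s = a :: s'.
  by case: (s) (nbr_in_s _ y1B xy1) => [|a s'] // _; exists a, s'.
have [y [yB xy ya]] : exists y, [/\ y \in B, e x y & y != a].
  have [y1a|] := eqVneq y1 a; last by exists y1.
  by exists y2; rewrite -y1a eq_sym.
have := nbr_in_s _ yB xy; rewrite Es inE (negPf ya) /= => /splitPr ys.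
(* The cycle is the initial piece of the path up to [y]; since [y] differs from [a], it has at least
   three vertices. *)
case: ys Es => s1 s2 Es; exists [:: x, a & rcons s1 y].
have sub : subseq [:: x, a & rcons s1 y] (x :: s).
  by rewrite Es /= !eqxx -cats1 -[y :: s2]cat1s catA prefix_subseq.
split; last by move=> z /(mem_subseq sub); rewrite inE => /orP[/eqP->|/(allP sB)].
rewrite /simple_cycle (subseq_uniq sub) /= ?xs' //.
rewrite size_rcons !ltnS andbT.
move: xs; rewrite Es /= cat_path /= => /and4P[-> as1 s1y _].
by rewrite !rcons_path as1 s1y last_rcons e_sym xy.
Qed.

(** Rotations bring any vertex to the front; nonempty [s1] and [s2] say that [x] and [y] are not
    consecutive on the cycle. *)
Definition chordless c := forall i x s1 y s2, rot i c = x :: s1 ++ y :: s2 ->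
  s1 != [::] -> s2 != [::] -> ~~ e x y.

(** A shortest cycle inside [B] works: a chord from [x] to [y] would cut off the shorter cycle
    [x :: rcons s1 y]. *)
Lemma exists_chordless_cycle (B : {set V}) b : b \in B ->
    (forall x, x \in B -> 1 < #|[set y in B | e x y]|) ->
  exists c, [/\ simple_cycle c, {subset c <= B} & chordless c].
Proof.
move=> bB /(exists_cycle bB)[c0 [cyc0 c0B]].
pose P n := [exists t : n.-tuple V, simple_cycle t && all (mem B) t].
have Pc c : simple_cycle c -> {subset c <= B} -> P (size c).
  by move=> cyc cB; apply/existsP; exists (in_tuple c); rewrite cyc; apply/allP.
case: (ex_minnP (ex_intro P _ (Pc _ cyc0 c0B))) => n /existsP[t /andP[cyc tB]].
move=> nmin; exists t; split=> //; first exact/allP.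
move=> i x s1 y s2 Et s10 s20; apply: contraL isT => xy.
have cyc' := cyc; rewrite -(simple_cycle_rot i) Et in cyc'.
have sub : subseq (x :: rcons s1 y) (x :: s1 ++ y :: s2).
  by rewrite /= eqxx -cats1 -[y :: s2]cat1s catA prefix_subseq.
suff /Pc H : simple_cycle (x :: rcons s1 y).
  have /nmin : P (size (x :: rcons s1 y)).
    by apply: H => z /(mem_subseq sub); rewrite -Et mem_rot => /(allP tB).
  rewrite -[n](size_tuple t) -(size_rot i) Et /= size_rcons size_cat /=.
  by rewrite addnS !ltnS; case: (s2) s20 => //= a s2' _; rewrite addnS ltnNge leq_addr.
case/and3P: cyc' => /(subseq_uniq sub) u.
rewrite /simple_cycle u /= rcons_cat cat_path /= => /and3P[xs1 s1y _] _.
rewrite rcons_path last_rcons (e_sym y) xy rcons_path xs1 s1y size_rcons.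
by case: (s1) s10.
Qed.

Lemma chordless_nbr c i x s y : simple_cycle c -> chordless c ->
  rot i c = x :: s -> y \in c -> e x y -> y = head x s \/ y = last x s.
Proof.
move=> cyc chord Ec; rewrite -(mem_rot i) Ec inE => /orP[/eqP->|].
  by rewrite e_irr.
move=> /splitPr ys; case: ys Ec => [[|a s1] [|b s2]] Ec xy.
- by left.
- by left.
- by right; rewrite last_cat.
- by have := chord _ _ _ _ _ Ec isT isT; rewrite xy.
Qed.

End Minors.

(** * Extending a precolouring inwards *)

Lemma disjoint_notin (T : finType) (A B : {set T}) :
  (forall x, x \in A -> x \notin B) -> [disjoint A & B].
Proof.
by move=> AB; rewrite disjoints_subset; apply/subsetP => x /AB; rewrite inE.
Qed.

Section Extension.
Variables (V : finType) (e : rel V).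
Hypotheses (e_sym : symmetric e) (e_irr : irreflexive e).
Variables (K : finType) (k0 : K).
Implicit Types (X W P Q S : {set V}) (L : V -> {set K}).

Definition nbrs X := [set y | [exists x in X, e x y]].

Definition colourable W L := exists phi : V -> K,
  (forall v, v \in W -> phi v \in L v) /\
  (forall u v, u \in W -> v \in W -> e u v -> phi u != phi v).

(* [X] is contracted to a vertex outside [W], whose neighbours
   [W :&: nbrs X] form the boundary; [P] is the precoloured clique, encoded by
   singleton lists. *)
Record extendable X W P L : Prop := Extendable {
  ext_conn : connected_set e X;
  ext_disj : [disjoint X & W];
  ext_sub : P \subset W :&: nbrs X;
  ext_card : #|P| <= 2;
  ext_clique : {in P &, forall x y, x != y -> e x y};
  ext_one : {in P, forall v, #|L v| = 1};
  ext_proper : {in P &, forall x y, x != y -> [disjoint L x & L y]};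
  ext_three : forall v, v \in W -> v \notin P -> 2 < #|L v|;
  ext_four : forall v, v \in W -> v \notin nbrs X -> 3 < #|L v|;
  ext_two : {in W &, forall x y, e x y -> #|L x :&: L y| <= 2};
  ext_tri : {in W & &, forall x y z, e x y -> e y z -> e x z ->
    #|L x :&: L y :&: L z| <= 1} }.

(** The induction hypothesis, measured by the number of vertices still to be coloured. *)
Definition extends_below n := forall X W P L,
  #|W| < n -> extendable X W P L -> colourable W L.

Lemma nbrsP X y : reflect (exists2 x, x \in X & e x y) (y \in nbrs X).
Proof.
rewrite inE; apply: (iffP existsP) => [[x /andP[? ?]]|[x ? ?]]; exists x => //.
exact/andP.
Qed.

Lemma nbrsU X Y : nbrs (X :|: Y) = nbrs X :|: nbrs Y.
Proof.
apply/setP => y; rewrite in_setU; apply/nbrsP/orP => [[x]|].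
  by rewrite inE => /orP[xX|xY] xy; [left | right]; apply/nbrsP; exists x.
by case=> /nbrsP[x xX xy]; exists x => //; rewrite inE xX ?orbT.
Qed.

Definition used (S : {set V}) (psi : V -> K) u := [set psi s | s in S & e s u].

(** Colour [S] by [psi], move it into [X] and remove the used colours from the neighbouring lists.
    Old boundary vertices lose nothing. A vertex that enters the boundary loses at most one of its
    four colours, and three is what the boundary requires. *)
Lemma colourable_delete X W P L S (psi : V -> K) :
    extends_below #|W| -> extendable X W P L ->
    S \subset W -> S != set0 -> connected_set e (X :|: S) ->
    {in S, forall s, psi s \in L s} ->
    {in S &, forall s t, e s t -> psi s != psi t} ->
    {in W :&: nbrs X :\: S & S, forall u s, e s u -> psi s \notin L u} ->
    {in W :\: nbrs X, forall u, #|used S psi u :&: L u| <= 1} ->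
  colourable W L.
Proof.
move=> IH [X_conn XW PB P2 Pcl P1 Pne L3 L4 Ltwo Ltri] SW S0 XS psiL psiP psiB psiI.
pose L' u := L u :\: used S psi u.
have L'B u : u \in W :&: nbrs X :\: S -> L' u = L u.
  move=> uB; apply/setDidPl; rewrite disjoint_sym; apply: disjoint_notin => c.
  by move=> /imsetP[s]; rewrite inE => /andP[sS su] ->; apply: psiB.
have L'sub u : L' u \subset L u by apply: subsetDl.
have W'W : #|W :\: S| < #|W|.
  rewrite cardsD (setIidPr SW) ltn_subrL !card_gt0 S0 /=.
  by case/set0Pn: S0 => s /(subsetP SW) sW; apply/set0Pn; exists s.
have P'B u : u \in P :\: S -> u \in W :&: nbrs X :\: S.
  by rewrite !inE => /andP[-> /(subsetP PB)]; rewrite !inE.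
have [] := IH (X :|: S) (W :\: S) (P :\: S) L' W'W.
  split=> //.
  - rewrite disjoint_sym; apply: disjoint_notin => x; rewrite !inE => /andP[/negPf-> xW].
    by rewrite orbF (disjointFl XW xW).
  - apply/subsetP => u /P'B; rewrite nbrsU !inE.
    by move=> /and3P[-> -> ->].
  - by apply: leq_trans P2; apply: subset_leq_card; apply: subsetDl.
  - by move=> x y; rewrite !inE => /andP[_ xP] /andP[_ yP]; apply: Pcl.
  - by move=> x xP; rewrite L'B ?P'B //; apply: P1; move: xP; rewrite inE => /andP[].
  - move=> x y xP yP; rewrite !L'B ?P'B //.
    by apply: Pne; move: xP yP; rewrite !inE => /andP[? ?] /andP[? ?].
  - move=> v vW' vP'; have vW : v \in W by move: vW'; rewrite inE => /andP[].
    have vS : v \notin S by move: vW'; rewrite inE => /andP[].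
    have vP : v \notin P by move: vP'; rewrite inE vS.
    have [vB|vB] := boolP (v \in nbrs X).
      by rewrite L'B ?L3 // !inE vS vW; move: vB; rewrite inE.
    have vI : v \in W :\: nbrs X by rewrite in_setD vB.
    have := L4 v vW vB; rewrite -(cardsID (used S psi v) (L v)) setIC.
    by move/leq_trans/(_ (leq_add (psiI v vI) (leqnn _))).
  - move=> v vW' vX'; have vW : v \in W by move: vW'; rewrite inE => /andP[].
    move: vX'; rewrite nbrsU in_setU negb_or => /andP[vX vS].
    suff -> : L' v = L v by apply: L4.
    apply/setDidPl; rewrite disjoint_sym; apply: disjoint_notin => c /imsetP[s].
    by rewrite inE => /andP[sS sv]; case/nbrsP: vS; exists s.
  - move=> x y; rewrite !inE => /andP[_ xW] /andP[_ yW] xy.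
    by apply: leq_trans (Ltwo _ _ xW yW xy); rewrite subset_leq_card ?setISS.
  - move=> x y z; rewrite !inE => /andP[_ xW] /andP[_ yW] /andP[_ zW] xy yz xz.
    by apply: leq_trans (Ltri _ _ _ xW yW zW xy yz xz); rewrite subset_leq_card ?setISS.
move=> phi [phiL phiP]; exists (fun v => if v \in S then psi v else phi v).
have W' v : v \in W -> v \notin S -> v \in W :\: S by rewrite !inE => -> ->.
have SP s u : s \in S -> u \in W -> u \notin S -> e s u -> psi s != phi u.
  move=> sS uW uS su; have := phiL u (W' u uW uS); rewrite inE => /andP[+ _].
  by apply: contraNneq => <-; apply/imsetP; exists s; rewrite // inE sS.
split=> [v vW|u v uW vW uv].
  have [vS|vS] := boolP (v \in S); first exact: psiL.
  by apply: (subsetP (L'sub v)); apply: phiL; apply: W'.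
have [uS|uS] := boolP (u \in S); have [vS|vS] := boolP (v \in S).
- exact: psiP.
- exact: SP.
- by rewrite eq_sym SP // e_sym.
- by apply: phiP => //; apply: W'.
Qed.

(** Colour the side [W1] that contains [P] first. The clique [W1 :&: W2] then serves as the
    precoloured clique for [W2], and as no edge joins the two differences, the colourings glue. *)
Lemma colourable_separate X W P L W1 W2 :
    extends_below #|W| -> extendable X W P L ->
    W1 :|: W2 = W -> W1 != W -> W2 != W -> P \subset W1 ->
    {in W1 :\: W2 & W2 :\: W1, forall x y, ~~ e x y} ->
    W1 :&: W2 \subset nbrs X -> #|W1 :&: W2| <= 2 ->
    {in W1 :&: W2 &, forall x y, x != y -> e x y} ->
  colourable W L.
Proof.
move=> IH [X_conn XW PB P2 Pcl P1 Pne L3 L4 Ltwo Ltri] W12 W1n W2n PW1 sep QX Q2 Qcl.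
have W1W : W1 \subset W by rewrite -W12 subsetUl.
have W2W : W2 \subset W by rewrite -W12 subsetUr.
have W1lt : #|W1| < #|W| by apply: proper_card; rewrite properEneq W1n.
have W2lt : #|W2| < #|W| by apply: proper_card; rewrite properEneq W2n.
have W1' v : v \in W1 -> v \in W by apply/subsetP.
have W2' v : v \in W2 -> v \in W by apply/subsetP.
have [|phi1 [phi1L phi1P]] := IH X W1 P L W1lt.
  split=> //.
  - exact: disjointWr XW.
  - rewrite subsetI PW1 /=; apply: subset_trans PB _; exact: subsetIr.
  - by move=> v /W1'; apply: L3.
  - by move=> v /W1'; apply: L4.
  - by move=> x y /W1' xW /W1' yW; apply: Ltwo.
  - by move=> x y z /W1' xW /W1' yW /W1' zW; apply: Ltri.
pose Q := W1 :&: W2.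
pose L2 v := if v \in Q then [set phi1 v] else L v.
have L2L v : L2 v \subset L v.
  rewrite /L2; case: ifP => // vQ; rewrite sub1set; apply: phi1L.
  by move: vQ; rewrite inE => /andP[].
have [|phi2 [phi2L phi2P]] := IH X W2 Q L2 W2lt.
  split=> //.
  - exact: disjointWr XW.
  - by rewrite subsetI QX subsetIr.
  - by move=> v vQ; rewrite /L2 vQ cards1.
  - move=> x y xQ yQ xy; rewrite /L2 xQ yQ disjoints1 inE.
    move: (xQ) (yQ); rewrite !inE => /andP[x1 _] /andP[y1 _].
    by apply: phi1P => //; apply: Qcl.
  - move=> v v2 vQ; rewrite /L2 (negPf vQ); apply: L3; first exact: W2'.
    by apply: contra vQ => /(subsetP PW1) v1; rewrite inE v1.
  - move=> v v2 vX; rewrite /L2 ifN; last by apply: contra vX => /(subsetP QX).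
    by apply: L4 => //; apply: W2'.
  - move=> x y /W2' xW /W2' yW xy.
    by apply: leq_trans (Ltwo _ _ xW yW xy); rewrite subset_leq_card ?setISS.
  - move=> x y z /W2' xW /W2' yW /W2' zW xy yz xz.
    by apply: leq_trans (Ltri _ _ _ xW yW zW xy yz xz); rewrite subset_leq_card ?setISS.
have phi12 v : v \in W1 -> v \in W2 -> phi2 v = phi1 v.
  by move=> v1 v2; have := phi2L v v2; rewrite /L2 inE v1 v2 /= => /set1P.
have in2 v : v \in W -> v \notin W1 -> v \in W2.
  by rewrite -W12 inE => /orP[->|].
have cross u v : u \in W1 -> v \in W -> v \notin W1 -> e u v -> phi1 u != phi2 v.
  move=> u1 vW v1 uv; have v2 := in2 v vW v1.
  have u2 : u \in W2.
    by apply: contraLR uv => u2; apply: sep; rewrite inE ?u1 ?v1 ?u2 ?v2.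
  by rewrite -phi12 // phi2P.
exists (fun v => if v \in W1 then phi1 v else phi2 v); split=> [v vW|u v uW vW uv].
  case: ifPn => v1; first exact: phi1L.
  by apply: (subsetP (L2L v)); apply: phi2L; apply: in2.
case: ifPn => u1; case: ifPn => v1.
- exact: phi1P.
- exact: cross.
- by rewrite eq_sym cross // e_sym.
- by apply: phi2P => //; apply: in2.
Qed.

(** Deletion with [S] a single vertex: an interior neighbour loses at most the colour [c], and by
    assumption boundary neighbours do not have [c]. *)
Lemma colourable_delete_vertex X W P L v c :
    extends_below #|W| -> extendable X W P L -> v \in W :&: nbrs X -> c \in L v ->
    (forall u, u \in W :&: nbrs X -> e v u -> c \notin L u) ->
  colourable W L.
Proof.
move=> IH ext /setIP[vW vX] cL cB.
apply: (@colourable_delete X W P L [set v] (fun=> c)) => //.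
- by rewrite sub1set.
- by apply/set0Pn; exists v; rewrite inE.
- case/nbrsP: vX => x xX xv.
  by rewrite setUC; apply: (connected_setU1 e_sym) xv => //; case: ext.
- by move=> s /set1P->.
- by move=> s t /set1P-> /set1P->; rewrite e_irr.
- by move=> u s /setDP[uB _] /set1P-> vu; apply: cB.
- move=> u _; apply: leq_trans (subset_leq_card (subsetIl _ _)) _.
  apply: leq_trans (leq_imset_card _ _) _; rewrite -(cards1 v).
  by apply: subset_leq_card; apply/subsetP => s; rewrite inE => /andP[].
Qed.

Lemma colourable_no_boundary X W P L :
    extends_below #|W| -> extendable X W P L -> W :&: nbrs X = set0 ->
  colourable W L.
Proof.
move=> IH ext B0; have [W0|[v vW]] := set_0Vmem W.
  by exists (fun=> k0); split=> [v|u v]; rewrite W0 inE.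
have [X_conn XW PB P2 Pcl P1 Pne L3 L4 Ltwo Ltri] := ext.
have P0 : P = set0 by apply/eqP; rewrite -subset0 -B0.
have noX u : u \in W -> u \notin nbrs X.
  by move=> uW; have /setP/(_ u) := B0; rewrite in_setI uW in_set0 /= => ->.
have nb0 : nbrs set0 = set0.
  by apply/setP => y; rewrite [RHS]inE; apply/nbrsP => -[x]; rewrite inE.
(* Adding [v] to [X] would disconnect it. Since nothing in [W] sees [X], restart from the empty set
   instead and let [v] alone become the new contracted part. *)
have ext' : extendable set0 W set0 L.
  split=> //; try by move=> x ?; rewrite inE.
  - by rewrite disjoints_subset sub0set.
  - exact: sub0set.
  - by rewrite cards0.
  - by move=> x; rewrite inE.
  - by move=> x xW _; apply: L3; rewrite // P0 inE.
  - by move=> x xW _; apply: L4 => //; apply: noX.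
have [c cL] : exists c, c \in L v.
  by apply/set0Pn; rewrite -card_gt0 (leq_trans _ (L4 _ vW (noX _ vW))).
apply: (@colourable_delete set0 W set0 L [set v] (fun=> c)) => //.
- by rewrite sub1set.
- by apply/set0Pn; exists v; rewrite inE.
- by rewrite set0U; apply: connected_set1.
- by move=> s /set1P->.
- by move=> s t /set1P-> /set1P->; rewrite e_irr.
- by move=> u s; rewrite nb0 setI0 set0D in_set0.
- move=> u _; apply: leq_trans (subset_leq_card (subsetIl _ _)) _.
  apply: leq_trans (leq_imset_card _ _) _; rewrite -(cards1 v).
  by apply: subset_leq_card; apply/subsetP => s; rewrite inE => /andP[].
Qed.

Definition no_private_colour X W L := forall v c, v \in W :&: nbrs X ->
  c \in L v -> exists u, [/\ u \in W :&: nbrs X, e v u & c \in L u].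

(** A precoloured vertex has the other one as a neighbour, and a second neighbour sharing its
    colour. For any other [x], a unique boundary neighbour [u] would contain all of [L x], giving
    three common colours on an edge. *)
Lemma boundary_degree X W P L x :
    extendable X W P L -> no_private_colour X W L -> #|P| = 2 ->
    x \in W :&: nbrs X ->
  1 < #|[set y in W :&: nbrs X | e x y]|.
Proof.
move=> [X_conn XW PB P2 Pcl P1 Pne L3 L4 Ltwo Ltri] priv cP xB.
have nbr w : (w \in [set y in W :&: nbrs X | e x y]) = (w \in W :&: nbrs X) && e x w.
  by rewrite in_set.
have [xP|xP] := boolP (x \in P).
  have [q qP qx] : exists2 q, q \in P & q != x.
    have /card_gt1P[p [q [pP qP pq]]] : 1 < #|P| by rewrite cP.
    by have [px|] := eqVneq p x; [exists q; rewrite // eq_sym -px | exists p].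
  have [c cL] : exists c, c \in L x by apply/set0Pn; rewrite -card_gt0 P1.
  have [u [uB xu cu]] := priv x c xB cL.
  apply/card_gt1P; exists q, u; rewrite !nbr uB xu (subsetP PB) // Pcl ?(eq_sym x) //.
  split=> //; apply: contraTneq cu => <-.
  by rewrite (disjointFr (Pne _ _ xP qP _) cL) // eq_sym.
have xW : x \in W by case/setIP: xB.
rewrite ltnNge; apply/negP => /card_le1P le1.
have [c cL] : exists c, c \in L x.
  by apply/set0Pn; rewrite -card_gt0 (leq_trans _ (L3 x xW xP)).
have [u [uB xu _]] := priv x c xB cL.
have Lxu : L x \subset L u.
  apply/subsetP => c' /(priv x c' xB)[u' [u'B xu' c'u']].
  have := le1 u; rewrite nbr uB xu => /(_ isT u'); rewrite nbr u'B xu' inE.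
  by move=> /esym/eqP <-.
have uW : u \in W by case/setIP: uB.
have := Ltwo _ _ xW uW xu.
by rewrite (setIidPl Lxu) leqNgt L3.
Qed.

(** * Attachments of a connected set to the boundary cycle *)

Lemma cycle_arcs a s1 b s2 d s3 : cycle e (a :: s1 ++ b :: s2 ++ d :: s3) ->
  [/\ path e a s1, path e b s2 & path e d s3] /\
  [/\ e (last a s1) b, e (last b s2) d & e (last d s3) a].
Proof.
rewrite /= rcons_cat cat_path /= rcons_cat cat_path /= rcons_path.
by case/and5P=> -> -> -> -> /andP[-> ->].
Qed.

Lemma three_on_cycle (c : seq V) (Q : {set V}) : uniq c -> {subset Q <= c} ->
    2 < #|Q| ->
  exists i a s1 b s2 d s3, rot i c = a :: s1 ++ b :: s2 ++ d :: s3 /\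
    [/\ a \in Q, b \in Q & d \in Q].
Proof.
move=> uc Qc /card_gt2P[x [y [w [[xQ yQ wQ] [xy yw wx]]]]].
have [i s Es] := rot_to (Qc x xQ).
have : y \in s by have := Qc y yQ; rewrite -(mem_rot i) Es inE eq_sym (negPf xy).
have : w \in s by have := Qc w wQ; rewrite -(mem_rot i) Es inE (negPf wx).
move=> + /splitPr ys; case: ys Es => s1 s2 Es.
rewrite mem_cat inE eq_sym (negPf yw) /= => /orP[] /splitPr ws.
- case: ws Es => t1 t2 Es; exists i, x, t1, w, t2, y, s2.
  by rewrite Es -catA.

- case: ws Es => t1 t2 Es; exists i, x, s1, y, t1, w, t2.
  by rewrite Es.
Qed.

(** Three attachments cut the cycle into three arcs, each starting at one of them. The arcs touch
    pairwise, and each touches both [X] and [D]; with [X] and [D] they form a K5 minor. *)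
Lemma attached_few X c D : K5_free e -> 
    connected_set e X -> connected_set e D -> simple_cycle e c ->
    [disjoint X & [set x in c]] -> [disjoint D & [set x in c]] ->
    [disjoint X & D] -> touching e X D -> {subset c <= nbrs X} ->
  #|[set x in c] :&: nbrs D| <= 2.
Proof.
move=> K5 cX cD cyc Xc Dc XD tXD cN; rewrite leqNgt; apply/negP.
have uc : uniq c by case/and3P: cyc.
move=> /(three_on_cycle uc)[x|i [a [s1 [b [s2 [d [s3 [Ec [aQ bQ dQ]]]]]]]]].
  by rewrite in_setI inE => /andP[].
have cyc' := cyc; rewrite -(simple_cycle_rot e i) Ec in cyc'.
case/and3P: cyc' => u /cycle_arcs[[as1 bs2 ds3] [ab bd da]] _.
have arc_c x : x \in c = (x \in a :: s1) || (x \in b :: s2) || (x \in d :: s3).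
  by rewrite -(mem_rot i) Ec !(in_cons, mem_cat) !orbA.
pose A := [set x in a :: s1]; pose B := [set x in b :: s2].
pose E := [set x in d :: s3].
have Ac : A \subset [set x in c] by apply/subsetP => x; rewrite !in_set arc_c => ->.
have Bc : B \subset [set x in c].
  by apply/subsetP => x; rewrite !in_set arc_c => ->; rewrite orbT.
have Cc : E \subset [set x in c].
  by apply/subsetP => x; rewrite !in_set arc_c => ->; rewrite orbT.
have tX (S : {set V}) x : x \in S -> x \in c -> touching e X S.
  by move=> xS /cN/nbrsP[y yX yx]; exists y, x.
have tD (S : {set V}) x : x \in S -> x \in [set x in c] :&: nbrs D -> touching e D S.
  by move=> xS /setIP[_ /nbrsP[y yX yx]]; exists y, x.
have inc x : x \in [set x in c] :&: nbrs D -> x \in c by rewrite in_setI inE => /andP[].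
have [aA bB dE] : [/\ a \in A, b \in B & d \in E] by rewrite !inE !eqxx.
have disj (s t : seq V) : ~~ has (mem s) t -> [disjoint [set x in s] & [set x in t]].
  move=> st; rewrite disjoint_sym; apply: disjoint_notin => x; rewrite !inE => xt.
  by apply: contra st => xs; apply/hasP; exists x.
move: u; rewrite -(cat_cons b s2) -(cat_cons a s1) cat_uniq has_cat negb_or cat_uniq.
case/and3P=> _ /andP[u1 u2] /and3P[_ u3 _].
apply: (no_K5 (A := X) (B := D) (C := A) (D := B) (E := E) K5 cX cD).
- exact: connected_path.
- exact: connected_path.
- exact: connected_path.
- by split=> //; apply: disjointWr Xc.
- by split=> //; apply: disjointWr Dc.
- by split; apply: disj.
- by split=> //; [apply: (tX _ a) | apply: (tX _ b) | apply: (tX _ d)]; rewrite // inc.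
- by split=> //; [apply: (tD _ a) | apply: (tD _ b) | apply: (tD _ d)].
split.
- by exists (last a s1), b; rewrite in_set mem_last.
- by exists a, (last d s3); rewrite !in_set mem_last mem_head e_sym.
- by exists (last b s2), d; rewrite in_set mem_last.
Qed.

(** If [x] and [y] are not adjacent, both open arcs of the cycle between them are nonempty. Then
    [x], [y], [X] on one side and [D] with the two arcs on the other form a K3,3 minor. *)
Lemma attached_adjacent X c D : K33_free e ->
    connected_set e X -> connected_set e D -> simple_cycle e c ->
    [disjoint X & [set x in c]] -> [disjoint D & [set x in c]] ->
    [disjoint X & D] -> touching e X D -> {subset c <= nbrs X} ->
  {in [set x in c] :&: nbrs D &, forall x y, x != y -> e x y}.
Proof.
move=> K33 cX cD cyc Xc Dc XD tXD cN x y xQ yQ xy; apply: contraT => nxy.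
have inc w : w \in [set x in c] :&: nbrs D -> w \in c by rewrite in_setI inE => /andP[].
have [i s Es] := rot_to (inc x xQ).
have : y \in s.
  by have := inc y yQ; rewrite -(mem_rot i) Es inE eq_sym (negPf xy).
move=> /splitPr ys; case: ys Es => s1 s2 Ec.
have cyc' := cyc; rewrite -(simple_cycle_rot e i) Ec in cyc'.
case/and3P: cyc' => u cy _; move: cy.
rewrite /= rcons_cat cat_path /=.
case: s1 Ec u => [|a s1] Ec u /=; first by case/andP=> xy'; rewrite xy' in nxy.
case: s2 Ec u => [|b s2] Ec u /=.
  by case/and3P=> _ _ /andP[yx]; rewrite e_sym yx in nxy.
rewrite rcons_path => /and3P[/andP[xa as1] s1y /and3P[yb bs2 s2x]].
have arc_c w : w \in c = [|| w == x, w \in a :: s1, w == y | w \in b :: s2].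
  by rewrite -(mem_rot i) Ec !(in_cons, mem_cat) ?orbA.
pose A := [set x in a :: s1]; pose B := [set x in b :: s2].
have Ac : A \subset [set x in c].
  by apply/subsetP => w; rewrite !in_set arc_c => ->; rewrite orbT.
have Bc : B \subset [set x in c].
  by apply/subsetP => w; rewrite !in_set arc_c => ->; rewrite !orbT.
have xc : [set x] \subset [set x in c] by rewrite sub1set inE inc.
have yc : [set y] \subset [set x in c] by rewrite sub1set inE inc.
have tX (S : {set V}) w : w \in S -> w \in c -> touching e X S.
  by move=> wS /cN/nbrsP[v vX vw]; exists v, w.
have tD (S : {set V}) w : w \in S -> w \in [set x in c] :&: nbrs D -> touching e S D.
  by move=> wS /setIP[_ /nbrsP[v vX vw]]; exists w, v; rewrite e_sym.
have [aA bB] : a \in A /\ b \in B by rewrite !inE !eqxx.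
have : uniq ([:: x] ++ (a :: s1) ++ [:: y] ++ (b :: s2)) by [].
rewrite cat_uniq (cat_uniq (a :: s1)) (cat_uniq [:: y]) 3!has_cat.
case/and3P=> _ /norP[xs1 /norP[xy' xs2]] /and3P[_ /norP[ys1 s12] /and3P[_ ys2 _]].
have disj (l l' : seq V) : ~~ has (mem l) l' -> [disjoint [set x in l] & [set x in l']].
  move=> st; rewrite disjoint_sym; apply: disjoint_notin => w; rewrite !inE => wt.
  by apply: contra st => ws; apply/hasP; exists w.
have set1E w : [set w] = [set v in [:: w]] by apply/setP => v; rewrite !inE.
exfalso; apply: (no_K33 (A := [set x]) (B := [set y]) (C := X) (D := D)
  (E := A) (F := B) K33) => //.
- exact: connected_set1.
- exact: connected_set1.
- exact: connected_path.
- exact: connected_path.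
- split.
  + by rewrite !set1E; apply: disj.
  + by rewrite disjoint_sym; apply: disjointWr Xc.
  + by rewrite disjoint_sym; apply: disjointWr Dc.
  + by rewrite set1E; apply: disj.
  + by rewrite set1E; apply: disj.
- split.
  + by rewrite disjoint_sym; apply: disjointWr Xc.
  + by rewrite disjoint_sym; apply: disjointWr Dc.
  + by rewrite disjoint_sym set1E; apply: disj.
  + by rewrite set1E; apply: disj.
- by split=> //; apply: disjointWr Xc.
- by split; [apply: disjointWr Dc | apply: disjointWr Dc | apply: disj].
- split; first by apply: (tD _ x) => //; apply: set11.
  + by exists x, a; rewrite !inE !eqxx.
  + by exists x, (last b s2); rewrite ?in_set ?in_set1 ?eqxx ?mem_last e_sym.
- split; first by apply: (tD _ y) => //; apply: set11.
  + by exists y, (last a s1); rewrite ?in_set ?in_set1 ?eqxx ?mem_last e_sym.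
  + by exists y, b; rewrite !inE !eqxx.
- by split=> //; [apply: (tX _ a) | apply: (tX _ b)]; rewrite // arc_c mem_head ?orbT.
Qed.

(** Let [D] be the component of [z] in [W] minus the cycle. Its attachments [Q] on the cycle form a
    clique of at most two boundary vertices, so they separate [D] from the rest. *)
Lemma colourable_off_cycle X W P L c z :
    K5_free e -> K33_free e -> extends_below #|W| -> extendable X W P L ->
    simple_cycle e c -> {subset c <= W :&: nbrs X} ->
    z \in W :&: nbrs X -> z \notin c ->
  colourable W L.
Proof.
move=> K5 K33 IH ext cyc cB /setIP[zW zX] zc.
have [X_conn XW PB P2 Pcl P1 Pne L3 L4 Ltwo Ltri] := ext.
pose C := [set x in c]; pose U := W :\: C.
have CB : C \subset W :&: nbrs X by apply/subsetP => x; rewrite in_set => /cB.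
have CW : C \subset W by apply: subset_trans CB (subsetIl _ _).
have zU : z \in U by rewrite in_setD in_set zc.
pose r a b := [&& e a b, a \in U & b \in U].
have r_sym : connect_sym r.
  by apply: sym_connect_sym => a b; rewrite /r e_sym; case: (a \in U) (b \in U) => [] [].
pose D := [set x | connect r z x].
have zD : z \in D by rewrite in_set connect0.
have r_path x s : path r x s -> path e x s.
  by apply: sub_path => a b /and3P[].
have DU : D \subset U.
  apply/subsetP => x; rewrite in_set => /connectP[s zs ->].
  elim/last_ind: s zs => [|s y _] //; rewrite rcons_path last_rcons.
  by case/andP=> _ /and3P[].
have D_step x y : x \in D -> y \in U -> e x y -> y \in D.
  move=> xD yU xy; have xU := subsetP DU x xD.
  move: xD; rewrite !in_set => /connect_trans; apply; apply: connect1.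
  by rewrite /r xy xU yU.
have D_conn : connected_set e D.
  apply: (connected_rooted e_sym (r := z)) => // x; rewrite in_set => /connectP[s zs ->].
  exists s; split=> //; first exact: r_path.
  move=> y ys; have {}ys : y \in z :: s by rewrite in_cons ys orbT.
  case/splitPl: ys zs => s1 s2 <-; rewrite cat_path => /andP[zs1 _].
  by rewrite in_set; apply/connectP; exists s1.
have DC : [disjoint D & C].
  by apply: disjoint_notin => x /(subsetP DU); rewrite in_setD => /andP[].
have DW : D \subset W by apply: subset_trans DU (subsetDl _ _).
have XC : [disjoint X & C] by apply: disjointWr XW.
have XD : [disjoint X & D] by apply: disjointWr XW.
have tXD : touching e X D by case/nbrsP: zX => x xX xz; exists x, z.
have cN : {subset c <= nbrs X} by move=> x /cB/setIP[].
pose Q := C :&: nbrs D.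
have Q2 : #|Q| <= 2 by apply: (attached_few (X := X)).
have Qcl : {in Q &, forall x y, x != y -> e x y}.
  exact: (attached_adjacent (X := X)).
have QC : Q \subset C by apply: subsetIl.
have QD : [disjoint Q & D] by rewrite disjoint_sym; apply: disjointWr DC.
have WI : (W :\: D) :&: (D :|: Q) = Q.
  apply/setP => x; rewrite in_setI in_setD in_setU.
  have [xQ|xQ] := boolP (x \in Q); last by rewrite orbF andbAC andNb.
  by rewrite (disjointFr QD xQ) (subsetP CW) // (subsetP QC).
have WU : (W :\: D) :|: (D :|: Q) = W.
  apply/setP => x; rewrite !in_setU in_setD.
  have [xD|xD] /= := boolP (x \in D); first by rewrite (subsetP DW).
  have [xW|xW] //= := boolP (x \in W).
  by apply: contraNF xW => /(subsetP QC)/(subsetP CW).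
have W1n : W :\: D != W.
  by apply/eqP => /setP/(_ z); rewrite in_setD zD zW.
(* Otherwise [Q] would be the whole cycle, which has at least three vertices. *)
have W2n : D :|: Q != W.
  apply: contraTneq Q2 => WE.
  have -> : Q = C.
    apply/eqP; rewrite eqEsubset QC; apply/subsetP => x xC.
    have : x \in W by rewrite (subsetP CW).
    by rewrite -WE in_setU (disjointFl DC xC).
  by rewrite -ltnNge cardsE (card_uniqP _); case/and3P: cyc.
have QX : Q \subset nbrs X.
  by apply: subset_trans QC _; apply: subset_trans CB (subsetIr _ _).
have cross x y : x \in W :\: D -> x \notin D :|: Q -> y \in D -> ~~ e x y.
  rewrite in_setD in_setU => /andP[xD xW]; rewrite (negPf xD) /= => xQ yD.
  apply/negP => xy; have [xC|xC] := boolP (x \in C).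
    by case/negP: xQ; rewrite in_setI xC; apply/nbrsP; exists y; rewrite // e_sym.
  by case/negP: xD; apply: (D_step y); rewrite ?in_setD ?xC // e_sym.
have sep : {in (W :\: D) :\: (D :|: Q) & (D :|: Q) :\: (W :\: D),
    forall x y, ~~ e x y}.
  move=> x y /setDP[x1 x2] /setDP[y2 y1]; apply: cross => //.
  move: y2; rewrite in_setU => /orP[//|yQ].
  by case/negP: y1; move: yQ; rewrite -WI => /setIP[].
have PW : P \subset W by apply: subset_trans PB (subsetIl _ _).
(* The side containing [P] has to be coloured first. If [P] meets [D], its other vertex is adjacent
   to a vertex of [D], hence [P] lies in [D :|: Q]. *)
have [PD|] := boolP (P \subset W :\: D).
  by apply: (colourable_separate IH ext WU W1n W2n PD sep); rewrite WI.
case/subsetPn => p pP; rewrite in_setD (subsetP PW) // andbT negbK => pD.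
have P2D : P \subset D :|: Q.
  apply/subsetP => q qP; have [<-|pq] := eqVneq p q; first by rewrite in_setU pD.
  have epq := Pcl _ _ pP qP pq; rewrite in_setU.
  have [qC|qC] := boolP (q \in C).
    by rewrite in_setI qC; apply/orP; right; apply/nbrsP; exists p.
  by rewrite (D_step p) // in_setD qC (subsetP PW).
apply: (colourable_separate (W1 := D :|: Q) (W2 := W :\: D) IH ext) => //.
- by rewrite setUC.
- by move=> x y x2 y1; rewrite e_sym; apply: sep.
- by rewrite setIC WI.
- by rewrite setIC WI.
- by rewrite setIC WI.
Qed.

(** * The induction step, by the number of precoloured vertices *)

Lemma chordless_rot i c : chordless e c -> chordless e (rot i c).
Proof.
by move=> chord j x s1 y s2; rewrite rot_rot_add; apply: chord.
Qed.

Lemma colourable_two_precoloured X W P L :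
    K5_free e -> K33_free e -> extends_below #|W| -> extendable X W P L ->
    #|P| = 2 -> colourable W L.
Proof.
move=> K5 K33 IH ext cP.
have [X_conn XW PB P2 Pcl P1 Pne L3 L4 Ltwo Ltri] := ext.
pose B := W :&: nbrs X.
have [/existsP[v /andP[vB /existsP[k /andP[kL /forallP priv]]]]|] :=
  boolP [exists v in B, [exists k in L v,
    [forall u, (u \in B) && e v u ==> (k \notin L u)]]].
  apply: (colourable_delete_vertex IH ext vB kL) => u uB vu.
  by have := priv u; rewrite uB vu.
move=> /existsPn nopriv.
have priv : no_private_colour X W L.
  move=> v k vB kL; have := nopriv v; rewrite vB /= => /existsPn/(_ k).
  rewrite kL /= => /forallPn[u]; rewrite negb_imply negbK => /andP[/andP[uB vu] ku].
  by exists u.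
have [p [q [pP qP pq]]] : exists p q, [/\ p \in P, q \in P & p != q].
  by apply/card_gt1P; rewrite cP.
have pB := subsetP PB p pP.
have [c [cyc cB chord]] := exists_chordless_cycle e_sym e_irr pB
  (fun x => boundary_degree ext priv cP).
have [/subsetPn[z zB]|] := boolP (~~ (B \subset [set x in c])).
  by rewrite in_set => zc; exact: (colourable_off_cycle K5 K33 IH ext cyc cB zB zc).
rewrite negbK => /subsetP Bc'.
have Bc x : x \in B -> x \in c by move=> /Bc'; rewrite in_set.
(* The two precoloured vertices are adjacent, hence consecutive on the chordless cycle; rotate so
   that it begins with them. If [q] precedes [p], one more rotation is needed. *)
have [a [b [i [t [Ec aP bP ab]]]]] : exists a b i t,
    [/\ rot i c = [:: a, b & t], a \in P, b \in P & a != b].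
  have [i s Es] := rot_to (Bc p pB).
  have [|qs|qs] := chordless_nbr e_irr cyc chord Es _ (Pcl _ _ pP qP pq).
  - exact/Bc/(subsetP PB).
  - case: s Es qs => [|a t] Es /= qs; first by rewrite qs eqxx in pq.
    by exists p, q, i, t; rewrite Es -qs.
  - case/lastP: s Es qs => [|t a] Es qs; first by rewrite qs eqxx in pq.
    rewrite last_rcons in qs; rewrite -qs -cats1 in Es.
    exists q, p, (rot_add c i (size (p :: t))), t.
    by rewrite -rot_rot_add Es -cat_cons rot_size_cat eq_sym.
have PE : P = [set b; a].
  by apply/eqP; rewrite eq_sym eqEcard cP cards2 eq_sym ab subUset !sub1set aP bP.
have cyc1 : simple_cycle e [:: a, b & t] by rewrite -Ec simple_cycle_rot.
have chord1 : chordless e [:: a, b & t] by rewrite -Ec; apply: chordless_rot.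
have memB u : (u \in B) = (u \in [:: a, b & t]).
  by rewrite -Ec mem_rot; apply/idP/idP => [/Bc|/cB].
case: t => [|x t] in Ec cyc1 chord1 memB; first by case/and3P: cyc1.
case/and3P: (cyc1) => uc1 cyce _.
have xB : x \in B by rewrite memB !inE eqxx !orbT.
have xW : x \in W by case/setIP: xB.
have xP : x \notin P.
  move: uc1 => /and3P[/=]; rewrite PE !inE !negb_or => /and3P[_ ax _] /andP[bx _] _.
  by rewrite eq_sym bx eq_sym.
have nbrx u : u \in B -> e x u -> u = head a t \/ u = b.
  rewrite memB => uc xu.
  have [->|->] := chordless_nbr e_irr cyc1 chord1 (i := 2)
    (x := x) (s := t ++ [:: a; b]) erefl uc xu.
  - by left; case: (t).
  - by right; rewrite last_cat.
have Lx : L x \subset L b :|: L (head a t).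
  apply/subsetP => d dx; have [u [uB xu du]] := priv x d xB dx.
  by rewrite in_setU; case: (nbrx u uB xu) => <-; rewrite du ?orbT.
(* On a triangle both boundary neighbours of [x] are precoloured, so [L x] would have at most two
   colours. *)
case: t => [|y t] in Ec cyc1 chord1 memB uc1 cyce nbrx Lx.
  have := leq_trans (L3 x xW xP) (leq_trans (subset_leq_card Lx) (leq_card_setU _ _)).
  by rewrite /= !P1.
move: Lx; rewrite /= => Lx.
have yB : y \in B by rewrite memB !inE eqxx !orbT.
have yW : y \in W by case/setIP: yB.
have [xy yP] : x != y /\ y \notin P.
  move: uc1 => /and4P[/=]; rewrite PE !inE !negb_or.
  by move=> /and4P[_ _ ay _] /and3P[_ yb _] /andP[-> _] _; rewrite eq_sym yb eq_sym ay.
have nbry u : u \in B -> e y u -> u = head a t \/ u = x.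
  rewrite memB => uc yu.
  have [->|->] := chordless_nbr e_irr cyc1 chord1 (i := 3)
    (x := y) (s := t ++ [:: a; b; x]) erefl uc yu.
  - by left; case: (t).
  - by right; rewrite last_cat.
(* [z] is the successor of [y] on the cycle; it is the precoloured [a] when the cycle has length
   four. *)
pose z := head a t.
have [exy eyz] : e x y /\ e y z.
  by move: cyce => /= /and4P[_ _ ->]; rewrite /z; case: (t) => [|? ?] /= /andP[].
have zB : z \in B by rewrite memB /z; case: (t) => [|? ?]; rewrite !inE eqxx ?orbT.
have zW : z \in W by case/setIP: zB.
have Ly : L y \subset L x :|: L z.
  apply/subsetP => d dy; have [u [uB yu du]] := priv y d yB dy.
  by rewrite in_setU; case: (nbry u uB yu) du => -> du; apply/orP; [right | left].
pose I := L x :&: L y.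
have I2 : #|I| <= 2 by apply: Ltwo.
have LxI : L x \subset L b :|: I.
  apply/subsetP => d dx; have := subsetP Lx d dx.
  by rewrite !in_setU in_setI dx.
(* [L x] has at least three colours, at most one of which comes from the singleton [L b]. *)
have I2' : #|I| = 2.
  apply/eqP; rewrite eqn_leq I2 /=.
  have := leq_trans (L3 x xW xP) (leq_trans (subset_leq_card LxI) (leq_card_setU _ _)).
  by rewrite P1 // add1n ltnS.
have Ib d : d \in I -> d \notin L b.
  move=> dI; apply/negP => db.
  have LbI : L b \subset I.
    have /eqP/cards1P[d' Ed'] := P1 b bP.
    by move: db; rewrite Ed' sub1set => /set1P <-.
  have := leq_trans (L3 x xW xP) (subset_leq_card LxI).
  by rewrite (setUidPr LbI) I2'.
(* If [L z] contained [I], a colour of [y] outside [I], which must also lie in [L z], would be a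
   third common colour of [y] and [z]. *)
have [k1 k1I k1z] : exists2 k1, k1 \in I & k1 \notin L z.
  apply/subsetPn; apply/negP => Iz.
  have [d dy dI] : exists2 d, d \in L y & d \notin I.
    apply/subsetPn; apply/negP => /subset_leq_card.
    by rewrite I2' leqNgt L3.
  have dz : d \in L z.
    have := subsetP Ly d dy; rewrite in_setU => /orP[dx|//].
    by rewrite in_setI dx dy in dI.
  have sub : d |: I \subset L y :&: L z.
    rewrite subUset sub1set in_setI dy dz subsetI Iz subsetIr //.
  have := leq_trans (subset_leq_card sub) (Ltwo _ _ yW zW eyz).
  by rewrite cardsU1 dI I2'.
have [k2 k2I k12] : exists2 k2, k2 \in I & k1 != k2.
  have : 0 < #|I :\ k1| by move: I2'; rewrite (cardsD1 k1) k1I add1n => -[->].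
  case/card_gt0P => k2; rewrite !inE eq_sym => /and3P[? ? ?].
  by exists k2; rewrite // !inE; apply/andP.
pose psi v := if v == x then k2 else k1.
have psix : psi x = k2 by rewrite /psi eqxx.
have psiy : psi y = k1 by rewrite /psi eq_sym (negPf xy).
have psiI v : psi v \in I by rewrite /psi; case: ifP.
apply: (colourable_delete (S := [set x; y]) (psi := psi) IH ext).
- by rewrite subUset !sub1set xW.
- by apply/set0Pn; exists x; rewrite !inE eqxx.
- have xX : exists2 w, w \in X & e w x by apply/nbrsP; case/setIP: xB.
  case: xX => w wX wx.
  have -> : X :|: [set x; y] = y |: (x |: X).
    by rewrite setUC [[set x; y]]setUC -setUA.
  apply: (connected_setU1 e_sym _ _ exy); last by rewrite in_setU1 eqxx.
  exact: (connected_setU1 e_sym X_conn wX wx).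
- move=> s; rewrite !inE => /orP[] /eqP->; rewrite ?psix ?psiy.
  + by move: k2I; rewrite in_setI => /andP[].
  + by move: k1I; rewrite in_setI => /andP[].
- move=> s s'; rewrite !inE => /orP[]/eqP-> /orP[]/eqP->; rewrite ?e_irr // psix psiy //.
  by rewrite eq_sym.
- move=> u s /setDP[uB uS]; rewrite !inE => /orP[]/eqP-> su; rewrite ?psix ?psiy.
  + have [uy|->] := nbrx u uB su; last exact: Ib.
    by move: uS; rewrite uy !inE eqxx orbT.
  + have [->|ux] := nbry u uB su; first exact: k1z.
    by move: uS; rewrite ux !inE eqxx.
move=> u /setDP[uW _].
(* Both colours used lie in [I]. A common neighbour of [x] and [y] has at most one colour of [I] by
   the triangle condition; any other interior vertex sees at most one vertex of [S]. *)
have [/andP[xu yu]|] := boolP (e x u && e y u).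
  apply: leq_trans (Ltri _ _ _ xW yW uW exy yu xu).
  by apply: subset_leq_card; apply: setSI; apply/subsetP => _ /imsetP[s _ ->].
move=> nxy; apply: leq_trans (subset_leq_card (subsetIl _ _)) _.
apply: leq_trans (leq_imset_card _ _) _.
have [xu|xu] := boolP (e x u).
  rewrite -(cards1 x); apply: subset_leq_card; apply/subsetP => s; rewrite !inE.
  case/andP=> /orP[//|/eqP->] yu; by rewrite xu yu in nxy.
rewrite -(cards1 y); apply: subset_leq_card; apply/subsetP => s; rewrite !inE.
by case/andP=> /orP[/eqP->|//]; rewrite (negPf xu).
Qed.

(** Shrinking a list preserves the upper bounds on intersections, so a boundary vertex adjacent to
    all of [P] may be added to [P]. This reduces smaller [P] to the case of two precoloured
    vertices. *)
Lemma precolour X W P L v k :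
    extendable X W P L -> #|P| < 2 -> v \in W :&: nbrs X -> v \notin P ->
    {in P, forall p, e p v} -> k \in L v -> {in P, forall p, k \notin L p} ->
  let L' u := if u == v then [set k] else L u in
  extendable X W (v |: P) L' /\ (colourable W L' -> colourable W L).
Proof.
move=> [X_conn XW PB P2 Pcl P1 Pne L3 L4 Ltwo Ltri] cP vB vP Pv kL kP L'.
have L'L u : L' u \subset L u.
  by rewrite /L'; case: eqP => [->|_] //; rewrite sub1set.
have Pnv p : p \in P -> (p == v) = false.
  by move=> pP; apply: contraNF vP => /eqP <-.
split; last first.
  case=> phi [phiL phiP]; exists phi; split=> // u uW.
  by apply: (subsetP (L'L u)); apply: phiL.
split=> //.
- by rewrite subUset sub1set vB.
- by rewrite cardsU1 vP.
- move=> x y; rewrite !in_setU1 => /orP[/eqP->|xP] /orP[/eqP->|yP]; rewrite ?eqxx //.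
  + by move=> _; rewrite e_sym Pv.
  + by move=> _; rewrite Pv.
  + exact: Pcl.
- by move=> u; rewrite in_setU1 /L'; case: eqP => [_ _|_ /= /P1]; rewrite ?cards1.
- move=> x y; rewrite !in_setU1 /L' => /orP[/eqP->|xP] /orP[/eqP->|yP]; rewrite ?eqxx //.
  + by rewrite (Pnv y) // disjoints1 kP.
  + by rewrite (Pnv x) // disjoint_sym disjoints1 kP.
  + by rewrite !Pnv //; apply: Pne.
- by move=> u uW; rewrite in_setU1 negb_or /L' => /andP[/negPf-> uP]; apply: L3.
- move=> u uW uX; rewrite /L'; case: eqP => [uv|_]; last exact: L4.
  by case/setIP: vB; rewrite -uv (negPf uX).
- move=> x y xW yW xy.
  by apply: leq_trans (Ltwo _ _ xW yW xy); rewrite subset_leq_card ?setISS.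
- move=> x y z xW yW zW xy yz xz.
  by apply: leq_trans (Ltri _ _ _ xW yW zW xy yz xz); rewrite subset_leq_card ?setISS.
Qed.

Lemma colourable_one_precoloured X W P L p :
    K5_free e -> K33_free e -> extends_below #|W| -> extendable X W P L ->
    P = [set p] -> colourable W L.
Proof.
move=> K5 K33 IH ext PE; have [_ _ PB _ _ P1 _ L3 _ _ _] := ext.
have pP : p \in P by rewrite PE set11.
have pB := subsetP PB p pP.
have [k1 kL] : exists k, k \in L p by apply/set0Pn; rewrite -card_gt0 P1.
(* If [p] has no boundary neighbour it can be deleted; otherwise some neighbour [u], with at least
   three colours, is precoloured differently from [p]. *)
have [/existsP[u /andP[uB pu]]|/existsPn none] :=
  boolP [exists u, (u \in W :&: nbrs X) && e p u]; last first.
  apply: (colourable_delete_vertex IH ext pB kL) => u uB pu.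
  by have := none u; rewrite uB pu.
have uP : u \notin P by rewrite PE in_set1; apply: contraTneq pu => ->; rewrite e_irr.
have uW : u \in W by case/setIP: uB.
have [k ku kp] : exists2 k, k \in L u & k \notin L p.
  apply/subsetPn; apply/negP => /subset_leq_card.
  by rewrite (P1 p pP) leqNgt (leq_trans _ (L3 u uW uP)).
have Pu : {in P, forall q, e q u} by move=> q; rewrite PE => /set1P->.
have Pk : {in P, forall q, k \notin L q} by move=> q; rewrite PE => /set1P->.
have cP : #|P| < 2 by rewrite PE cards1.
have [ext' back] := precolour ext cP uB uP Pu ku Pk.
by apply/back/(colourable_two_precoloured K5 K33 IH ext'); rewrite cardsU1 uP PE cards1.
Qed.

Lemma extendable_colourable X W P L :
  K5_free e -> K33_free e -> extendable X W P L -> colourable W L.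
Proof.
move=> K5 K33; move: {2}#|W|.+1 (ltnSn #|W|) => n; elim: n => // n IHn in X W P L *.
rewrite ltnS => Wn ext.
have IH : extends_below #|W|.
  by move=> X' W' P' L' W'W; apply: IHn; apply: leq_trans Wn.
have [_ _ PB P2 _ P1 _ L3 _ _ _] := ext.
have [P0|[p pP]] := set_0Vmem P; last first.
  have [cP|cP] := eqVneq #|P| 2; first exact: (colourable_two_precoloured K5 K33 IH ext).
  apply: (colourable_one_precoloured (p := p) K5 K33 IH ext); apply/eqP.
  by rewrite eq_sym eqEcard sub1set pP cards1 -ltnS ltn_neqAle cP.
have [B0|[v vB]] := set_0Vmem (W :&: nbrs X).
  exact: colourable_no_boundary IH ext B0.
have vW : v \in W by case/setIP: vB.
have vP : v \notin P by rewrite P0 in_set0.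
have [k kL] : exists k, k \in L v.
  by apply/set0Pn; rewrite -card_gt0 (leq_trans _ (L3 v vW vP)).
have [|||ext' back] := precolour ext _ vB vP _ kL.
- by rewrite P0 cards0.
- by move=> q; rewrite P0 in_set0.
- by move=> q; rewrite P0 in_set0.
apply/back/(colourable_one_precoloured (p := v) K5 K33 IH ext').
by rewrite P0 setU0.
Qed.

Lemma minor_free_colourable L :
    K5_free e -> K33_free e -> (forall v, 3 < #|L v|) ->
    (forall x y, e x y -> #|L x :&: L y| <= 2) ->
    (forall x y z, e x y -> e y z -> e x z -> #|L x :&: L y :&: L z| <= 1) ->
  colourable [set: V] L.
Proof.
move=> K5 K33 L4 L2 L1; apply: (@extendable_colourable set0 _ set0) => //.
split=> //; try by move=> x ? ; rewrite in_set0.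
- by rewrite disjoints_subset sub0set.
- exact: sub0set.
- by rewrite cards0.
- by move=> x; rewrite in_set0.
- by move=> v _ _; apply: ltnW.
- by move=> x y _ _; apply: L2.
- by move=> x y z _ _ _; apply: L1.
Qed.

End Extension.

(** * Parity of crossings of separated polygonal walks *)

From mathcomp Require Import all_order all_algebra.
From Stdlib Require Import Btauto.
Import Order.TTheory GRing.Theory Num.Theory.

Section Parity.
Local Open Scope ring_scope.
Variable R : realDomainType.
Implicit Types (a b p : R * R) (e f : (R * R) * (R * R)).
Implicit Types l : seq ((R * R) * (R * R)).

(* Ties between abscissae are broken by the ordinates, so that distinct points
   are always strictly ordered and no general position is needed. *)
Definition lexlt a b := (a.1 < b.1) || ((a.1 == b.1) && (a.2 < b.2)).

Definition below (a b c d : R) := [&& a < c, a < d, b < c & b < d].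

(** In this order: [e] lies to the left of, to the right of, under or over [f]. *)
Definition axis_separated e f :=
  [|| below e.1.1 e.2.1 f.1.1 f.2.1, below f.1.1 f.2.1 e.1.1 e.2.1,
      below e.1.2 e.2.2 f.1.2 f.2.2 | below f.1.2 f.2.2 e.1.2 e.2.2].

(** The vertical line through [p], tilted slightly to break ties, separates the end points of
    [e]. *)
Definition straddles p e := lexlt e.1 p (+) lexlt e.2 p.

(** Comparing with one end of [e] is enough when [e] is axis separated from a segment ending in [p]:
    if [e] straddles [p], both its ends are then on the same side of [p] vertically. *)
Definition crossed_above p e := straddles p e && (p.2 < e.1.2).
Definition crossed_below p e := straddles p e && (e.1.2 < p.2).

Lemma lexlt_x a b : a.1 < b.1 -> lexlt a b /\ lexlt b a = false.
Proof.
move=> ab; rewrite /lexlt ab; split=> //.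
by rewrite ltNge (ltW ab) /= gt_eqF.
Qed.

Lemma lexltN a b : a != b -> lexlt b a = ~~ lexlt a b.
Proof.
rewrite /lexlt; case: a b => [a1 a2] [b1 b2] /=; rewrite xpair_eqE.
by case: (ltgtP a1 b1) => //= _; case: (ltgtP a2 b2).
Qed.

Lemma neq_y a b : a.2 < b.2 -> a != b.
Proof. by move=> ab; apply: contraTneq ab => ->; rewrite ltxx. Qed.

(** Segments side by side straddle nothing, and if [e] is over [f] every term is false. If [e] is
    under [f], each of the four pairs of ends contributes a comparison and its negation, and four
    ones cancel. *)
Lemma separated_crossings e f : axis_separated e f ->
  (crossed_above e.1 f (+) crossed_above e.2 f) (+)
  (crossed_below f.1 e (+) crossed_below f.2 e) = false.
Proof.
case: e f => [a a'] [b b']; rewrite /axis_separated /crossed_above /crossed_below.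
rewrite /straddles /below /=; case/or4P=> /and4P[].
- move=> /lexlt_x[-> ->] /lexlt_x[-> ->] /lexlt_x[-> ->] /lexlt_x[-> ->].
  by [].
- move=> /lexlt_x[-> ->] /lexlt_x[-> ->] /lexlt_x[-> ->] /lexlt_x[-> ->].
  by [].
- move=> ab ab' a'b a'b'.
  rewrite ab a'b ab' !andbT.
  rewrite (lexltN (neq_y ab)) (lexltN (neq_y ab')).
  rewrite (lexltN (neq_y a'b)) (lexltN (neq_y a'b')).
  by do 4!case: (lexlt _ _).
- move=> ab ab' a'b a'b'.
  by rewrite (lt_gtF ab) (lt_gtF ab') (lt_gtF a'b) !andbF.
Qed.

Lemma separated_straddles e f p : axis_separated e f -> p \in [:: f.1; f.2] ->
  crossed_above p e (+) crossed_below p e = straddles p e.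
Proof.
case: e f => [a a'] [b b']; rewrite /axis_separated /crossed_above /crossed_below.
rewrite /straddles /below /= !inE => s bp.
move: s; case/or4P=> /and4P[].
- move=> + + + +; case/orP: bp => /eqP ->.
  + by move=> /lexlt_x[-> _] _ /lexlt_x[-> _] _.
  + by move=> _ /lexlt_x[-> _] _ /lexlt_x[-> _].
- move=> + + + +; case/orP: bp => /eqP ->.
  + by move=> /lexlt_x[_ ->] /lexlt_x[_ ->] _ _.
  + by move=> _ _ /lexlt_x[_ ->] /lexlt_x[_ ->].
- move=> ab ab' _ _; suff ap : a.2 < p.2 by rewrite ap ltNge (ltW ap) andbF andbT.
  by case/orP: bp => /eqP ->.
- move=> ab _ ab' _; suff ap : p.2 < a.2.
    by rewrite ap ltNge (ltW ap) andbF andbT addbF.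
  by case/orP: bp => /eqP ->.
Qed.

(* Encodes that [l] lists the segments of a walk from [a] to [b] through the
   only property used: telescoping. *)
Definition segment_chain l a b := forall h : R * R -> bool,
  \big[addb/false]_(e <- l) (h e.1 (+) h e.2) = h a (+) h b.

Lemma segment_chain_nil a : segment_chain [::] a a.
Proof. by move=> h; rewrite big_nil addbb. Qed.

Lemma segment_chain_cat l l' a b c :
  segment_chain l a b -> segment_chain l' b c -> segment_chain (l ++ l') a c.
Proof.
by move=> ab bc h; rewrite big_cat /= ab bc; do 3!case: (h _).
Qed.

Lemma segment_chain_iota (q : nat -> R * R) n :
  segment_chain [seq (q k, q k.+1) | k <- iota 0 n] (q 0) (q n).
Proof.
elim: n => [|n IH]; first exact: segment_chain_nil.
rewrite -addn1 iotaD map_cat; apply: (segment_chain_cat IH).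
by move=> h; rewrite big_seq1 addn1.
Qed.

Definition parity_above p l := \big[addb/false]_(e <- l) crossed_above p e.
Definition parity_below p l := \big[addb/false]_(e <- l) crossed_below p e.

(** Telescoping rewrites both differences as sums over segments; together they are the sum of
    [separated_crossings] over all pairs. *)
Lemma chains_parity l l' a b c d :
  segment_chain l a b -> segment_chain l' c d ->
  {in l & l', forall e f, axis_separated e f} ->
  (parity_above a l' (+) parity_above b l') (+)
  (parity_below c l (+) parity_below d l) = false.
Proof.
move=> ab cd sep.
rewrite -(ab (parity_above^~ l')) -(cd (parity_below^~ l)).
under eq_bigr do rewrite -big_split /=.
under [X in _ (+) X]eq_bigr do rewrite -big_split /=.
rewrite exchange_big -big_split /= big_seq big1 // => f fl.
rewrite -big_split /= big_seq big1 // => e el.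
by apply: separated_crossings; apply: sep.
Qed.

Lemma segment_chain_straddles l a b p : segment_chain l a b ->
  {in l, forall e, exists2 f, axis_separated e f & p \in [:: f.1; f.2]} ->
  parity_above p l (+) parity_below p l = lexlt a p (+) lexlt b p.
Proof.
move=> ab sep; rewrite -(ab (lexlt^~ p)) -big_split /= big_seq [RHS]big_seq.
by apply: eq_bigr => e /sep[f ef pf]; rewrite (separated_straddles ef pf).
Qed.

(** [segment_chain_straddles] trades the below terms of [chains_parity] for above terms and
    comparisons. For distinct end points the right-hand side says that the pairs [a], [b] and [c],
    [d] interleave. *)
Lemma chains_interleave l l' a b c d :
    segment_chain l a b -> segment_chain l' c d ->
    {in l & l', forall e f, axis_separated e f} ->
    (exists2 f, f \in l' & c \in [:: f.1; f.2]) ->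
    (exists2 f, f \in l' & d \in [:: f.1; f.2]) ->
  (parity_above a l' (+) parity_above b l') (+)
  (parity_above c l (+) parity_above d l) =
  (lexlt a c (+) lexlt b c) (+) (lexlt a d (+) lexlt b d).
Proof.
move=> ab cd sep [f fl cf] [f' fl' df].
rewrite -(segment_chain_straddles (p := c) ab); last first.
  by move=> e el; exists f => //; apply: sep.
rewrite -(segment_chain_straddles (p := d) ab); last first.
  by move=> e el; exists f' => //; apply: sep.
have := chains_parity ab cd sep.
by do 4!case: (parity_above _ _); do 2!case: (parity_below _ _).
Qed.
End Parity.

(* [u i k l] stands for the parity above point [i] of the walk from [k] to [l],
   and [o] for the order of the points. *)
Definition parity_sum (o : rel nat) (u : nat -> nat -> nat -> bool)
    (i j k l : nat) :=
  ((u i k l (+) u j k l) (+) (u k i j (+) u l i j)) (+)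
  ((o i k (+) o j k) (+) (o i l (+) o j l)).

Lemma addbE a b : a (+) b = xorb a b. Proof. by case: a b => [] []. Qed.

Lemma K5_parity (o : rel nat) (u : nat -> nat -> nat -> bool) :
    (forall i j, i < j < 5 -> o j i = ~~ o i j)%N ->
    (forall i j k l, i < j < 5 -> k < l < 5 -> uniq [:: i; j; k; l] ->
      parity_sum o u i j k l = false)%N ->
  False.
Proof.
move=> oN H.
have Hs (s : seq (nat * nat * nat * nat)) :
    all (fun q => let: (i, j, k, l) := q in
      [&& i < j < 5, k < l < 5 & uniq [:: i; j; k; l]])%N s ->
    \big[addb/false]_(q <- s) (let: (i, j, k, l) := q in parity_sum o u i j k l)
      = false.
  move=> /allP sP; rewrite big_seq big1 // => -[[[i j] k] l] /sP /and3P[*].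
  exact: H.
(* These are the 15 pairs of disjoint edges. A term [u i k l] occurs for both choices of the other
   end of the edge at [i], so it cancels; the order terms add up to [true]. *)
have := Hs [:: (0,1,2,3); (0,1,2,4); (0,1,3,4); (0,2,1,3); (0,2,1,4); (0,2,3,4);
  (0,3,1,2); (0,3,1,4); (0,3,2,4); (0,4,1,2); (0,4,1,3); (0,4,2,3);
  (1,2,3,4); (1,3,2,4); (1,4,2,3)]%N isT.
rewrite !big_cons big_nil /parity_sum.
rewrite ?(oN 1 2 isT)%N ?(oN 1 3 isT)%N ?(oN 1 4 isT)%N ?(oN 2 3 isT)%N.
rewrite ?(oN 2 4 isT)%N ?(oN 3 4 isT)%N !addbE => E.
by suff: false = true by []; rewrite -[LHS]E; btauto.
Qed.

Lemma K33_parity (o : rel nat) (u : nat -> nat -> nat -> bool) :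
    (forall i j, i < j < 6 -> o j i = ~~ o i j)%N ->
    (forall i j k l, i < 3 <= j -> k < 3 <= l -> maxn j l < 6 ->
      uniq [:: i; j; k; l] -> parity_sum o u i j k l = false)%N ->
  False.
Proof.
move=> oN H.
have Hs (s : seq (nat * nat * nat * nat)) :
    all (fun q => let: (i, j, k, l) := q in
      [&& i < 3 <= j, k < 3 <= l, maxn j l < 6 & uniq [:: i; j; k; l]])%N s ->
    \big[addb/false]_(q <- s) (let: (i, j, k, l) := q in parity_sum o u i j k l)
      = false.
  move=> /allP sP; rewrite big_seq big1 // => -[[[i j] k] l] /sP /and4P[*].
  exact: H.
(* The 18 pairs of disjoint edges of K3,3; again each term of [u] occurs twice and the order terms
   add up to [true]. *)
have := Hs [:: (0,3,1,4); (0,3,1,5); (0,4,1,3); (0,4,1,5); (0,5,1,3); (0,5,1,4);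
  (0,3,2,4); (0,3,2,5); (0,4,2,3); (0,4,2,5); (0,5,2,3); (0,5,2,4);
  (1,3,2,4); (1,3,2,5); (1,4,2,3); (1,4,2,5); (1,5,2,3); (1,5,2,4)]%N isT.
rewrite !big_cons big_nil /parity_sum.
have oN' i j : (i < 3 <= j)%N -> (j < 6)%N -> o j i = ~~ o i j.
  by move=> /andP[i3 j3] j6; apply: oN; rewrite (leq_trans i3 j3).
rewrite ?(oN 3 4 isT)%N ?(oN 3 5 isT)%N ?(oN 4 5 isT)%N.
rewrite ?(oN' _ 3 isT isT)%N ?(oN' _ 4 isT isT)%N ?(oN' _ 5 isT isT)%N.
rewrite !addbE => E.
by suff: false = true by []; rewrite -[LHS]E; btauto.
Qed.

(** * Plane drawings *)

Require Import Defs.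
From mathcomp Require Import all_classical all_reals all_analysis.
From mathcomp Require Import lra.
Import numFieldNormedType.Exports.

Section Sampling.
Local Open Scope classical_set_scope.
Local Open Scope ring_scope.

Lemma within_continuous_eps (R : realType) (f : R -> R * R) (s0 e : R) :
    {within `[0, 1], continuous f} -> 0 <= s0 <= 1 -> 0 < e ->
  exists2 d : R, 0 < d & forall s, 0 <= s <= 1 -> `|s0 - s| < d ->
    `|(f s0).1 - (f s).1| < e /\ `|(f s0).2 - (f s).2| < e.
Proof.
move=> fc s01 e0.
have s0I : `[0, 1]%classic s0 by rewrite /= in_itv.
have := fc s0 (ball (f s0) e) (nbhsx_ballx _ _ e0).
rewrite nbhs_simpl /= /nbhs /= -(nbhs_subspace_in s0I).
rewrite /within /= => /nbhs_ballP[d /= d0 dP].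
exists d => // s s01' sd.
have [] := dP s sd; first by rewrite /= in_itv.
by rewrite /ball /=.
Qed.

(** At each parameter pair the two points differ in some coordinate, and by continuity this gap
    persists nearby. Compactness of the parameter square makes the step size uniform. *)
Lemma disjoint_arcs_separated (R : realType) (f h : R -> R * R) :
    {within `[0, 1], continuous f} -> {within `[0, 1], continuous h} ->
    (forall s t, 0 <= s <= 1 -> 0 <= t <= 1 -> f s <> h t) ->
  \forall d \near 0^'+, forall s s' t t' : R,
    [/\ 0 <= s <= 1, 0 <= s' <= 1, 0 <= t <= 1 & 0 <= t' <= 1] ->
    `|s - s'| < d -> `|t - t'| < d -> axis_separated (f s, f s') (h t, h t').
Proof.
move=> fc hc fh.
pose K := `[(0:R), 1]%classic `*` `[(0:R), 1]%classic.
have cK : compact K by apply: compact_setX; exact: segment_compact.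
pose P (d : R) (x : R * R) := forall s' t' : R, 0 <= s' <= 1 -> 0 <= t' <= 1 ->
  `|x.1 - s'| < d -> `|x.2 - t'| < d ->
  axis_separated (f x.1, f s') (h x.2, h t').
suff : \forall d \near (0 : R)^'+, K `<=` P d.
  apply: filterS => d KP s s' t t' [s1 s'1 t1 t'1] ss tt.
  apply: (KP (s, t)) => //; by split; rewrite /= in_itv.
move/compact_near_coveringP/near_covering_withinP: cK; apply.
move=> [s0 t0] /= [/=]; rewrite !in_itv /= => s01 t01.
have sep : exists2 e : R, 0 < e & forall a a' b b' : R * R,
    (`|(f s0).1 - a.1| < e /\ `|(f s0).2 - a.2| < e) ->
    (`|(f s0).1 - a'.1| < e /\ `|(f s0).2 - a'.2| < e) ->
    (`|(h t0).1 - b.1| < e /\ `|(h t0).2 - b.2| < e) ->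
    (`|(h t0).1 - b'.1| < e /\ `|(h t0).2 - b'.2| < e) ->
    axis_separated (a, a') (b, b').
  have near (x y : R) : x < y -> exists2 e : R, 0 < e &
      forall z w, `|x - z| < e -> `|y - w| < e -> z < w.
    move=> xy; exists ((y - x) / 2); first by rewrite divr_gt0 ?subr_gt0.
    by move=> z w; rewrite !ltr_norml => /andP[? ?] /andP[? ?]; lra.
  have := fh s0 t0 s01 t01.
  case: (f s0) (h t0) => [x y] [x' y'] /= ne.
  have : [|| x < x', x' < x, y < y' | y' < y].
    case: (ltgtP x x') => //= xx; case: (ltgtP y y') => //= yy.
    by case: ne; rewrite xx yy.
  case/or4P => /near[e e0 eP]; exists e => // a a' b b' [? ?] [? ?] [? ?] [? ?];
    apply/or4P; [apply: Or41 | apply: Or42 | apply: Or43 | apply: Or44];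
    by apply/and4P; split; apply: eP.
have [e e0 eP] := sep.
have [d1 d10 d1P] := within_continuous_eps fc s01 e0.
have [d2 d20 d2P] := within_continuous_eps hc t01 e0.
(* Halving leaves room for two moves: from the centre to [s] or [t], then on to [s'] or [t']. *)
have [d d0 [dd1 dd2]] : exists2 d : R, 0 < d & d + d <= d1 /\ d + d <= d2.
  exists (Num.min d1 d2 / 2); first by rewrite divr_gt0 // lt_min d10.
  by rewrite -splitr !ge_min !lexx orbT.
have ball_half (x y z i c : R) : d + d <= c -> i < d ->
    `|x - y| < d -> `|y - z| < i -> `|x - z| < c.
  move=> dc id xy yz; apply: (lt_le_trans _ dc).
  have -> : x - z = (x - y) + (y - z) by rewrite addrA subrK.
  by apply: le_lt_trans (ler_normD _ _) _; rewrite ltrD // (lt_trans yz).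
have half_ball (x y c : R) : d + d <= c -> `|x - y| < d -> `|x - y| < c.
  by move=> dc xy; apply: lt_le_trans dc; rewrite (lt_trans xy) // ltrDl.
exists (ball (s0, t0) d, [set x | x < d]).
  split; first exact: nbhsx_ballx.
  exact: nbhs_right_lt.
move=> [[s t] i] /= [[]]; rewrite /ball /= => sd td id [].
rewrite /= !in_itv /= => s1 t1 s' t' s'1 t'1 ss tt.
apply: eP.
- by apply: d1P => //; apply: half_ball sd.
- by apply: d1P => //; apply: ball_half sd ss.
- by apply: d2P => //; apply: half_ball td.
- by apply: d2P => //; apply: ball_half td tt.
Qed.

Lemma planar_sampling (R : realType) (G : sgraph) : planar R G ->
  exists (p : G -> R * R) (n : nat) (q : G -> G -> nat -> R * R),
  [/\ injective p,
      (0 < n)%N,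
      forall u v, adj u v -> q u v 0%N = p u /\ q u v n = p v
    & forall u v u' v', adj u v -> adj u' v' ->
      [/\ u != u', u != v', v != u' & v != v'] ->
      forall i j, (i < n)%N -> (j < n)%N ->
      axis_separated (q u v i, q u v i.+1) (q u' v' j, q u' v' j.+1)].
Proof.
move=> [p [g [p_inj arcs g_rev g_p g_g]]].
have near_sep : \forall d \near (0 : R)^'+, forall x : (G * G) * (G * G),
    adj x.1.1 x.1.2 -> adj x.2.1 x.2.2 ->
    [/\ x.1.1 != x.2.1, x.1.1 != x.2.2, x.1.2 != x.2.1 & x.1.2 != x.2.2] ->
    forall s s' t t' : R,
    [/\ 0 <= s <= 1, 0 <= s' <= 1, 0 <= t <= 1 & 0 <= t' <= 1] ->
    `|s - s'| < d -> `|t - t'| < d ->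
    axis_separated (g x.1.1 x.1.2 s, g x.1.1 x.1.2 s') (g x.2.1 x.2.2 t, g x.2.1 x.2.2 t').
  (* There are finitely many pairs of edges, so each may be given its own step size. *)
  apply: filter_forall => -[[u v] [u' v']] /=.
  have [uv|nuv] := boolP (adj u v); last by near=> d.
  have [uv'|nuv'] := boolP (adj u' v'); last by near=> d.
  have [[uu uw vu vw]|nd] := pselect [/\ u != u', u != v', v != u' & v != v'];
    last by near=> d.
  have [gc _ g0 g1] := arcs _ _ uv; have [gc' _ g0' g1'] := arcs _ _ uv'.
  have := disjoint_arcs_separated gc gc'; set D := forall s t, _.
  suff d : D by move=> /(_ d); apply: filterS => e H _ _ _; apply: H.
  have ends (w w' : G) (x : R) : adj w w' -> 0 <= x <= 1 ->
      [\/ x = 0 /\ g w w' x = p w, x = 1 /\ g w w' x = p w' | 0 < x < 1].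
    move=> /arcs[_ _ h0 h1] /andP[]; rewrite le_eqVlt => /orP[/eqP <- _|x0].
      by constructor 1.
    rewrite le_eqVlt => /orP[/eqP ->|x1]; first by constructor 2.
    by constructor 3; rewrite x0.
  have pp w w' : w != w' -> p w <> p w' by move=> /eqP ww /p_inj.
  have neq : [set u; v]%SET != [set u'; v']%SET.
    by apply/eqP => /setP/(_ u); rewrite !inE eqxx (negPf uu) (negPf uw).
  move=> s t /(ends _ _ _ uv)[[_ ->]|[_ ->]|s01] /(ends _ _ _ uv')[[_ ->]|[_ ->]|t01].
  - exact: pp.
  - exact: pp.
  - by move=> e; apply: (g_p _ _ u _ uv' t01).
  - exact: pp.
  - exact: pp.
  - by move=> e; apply: (g_p _ _ v _ uv' t01).
  - exact: g_p.
  - exact: g_p.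
  - exact: g_g.
have [d [dsep d0]] := filter_ex (filterI near_sep (nbhs_right_gt (0 : R))).
have [n] := ltr_add_invr d0; rewrite add0r => nd.
exists p, n.+1, (fun u v i => g u v (i%:R / n.+1%:R)); split => //.
  move=> u v /arcs[_ _ g0 g1]; split; first by rewrite mul0r.
  by rewrite divff // pnatr_eq0.
have n0 : 0 < n.+1%:R :> R by rewrite ltr0n.
have I01 i : (i <= n.+1)%N -> 0 <= (i%:R / n.+1%:R : R) <= 1.
  by move=> i_n; rewrite divr_ge0 //= ler_pdivrMr // mul1r ler_nat.
have step i : `|i%:R / n.+1%:R - i.+1%:R / n.+1%:R : R| < d.
  by rewrite -mulrBl -[i.+1]addn1 natrD opprD addNKr mulN1r normrN gtr0_norm ?invr_gt0.
move=> u v u' v' uv uv' dis i j i_n j_n.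
by apply: (dsep ((u, v), (u', v'))) => //; split; apply: I01; rewrite // ltnW.
Unshelve. all: by end_near. Qed.

End Sampling.

(** * From minors to walks along sampled edges *)

Section Sampled.
Variables (R : realType) (G : sgraph).
Variables (p : G -> R * R) (n : nat) (q : G -> G -> nat -> R * R).
Hypotheses (p_inj : injective p) (n_gt0 : 0 < n).
Hypothesis q_ends : forall u v, adj u v -> q u v 0 = p u /\ q u v n = p v.
Hypothesis q_sep : forall u v u' v', adj u v -> adj u' v' ->
  [/\ u != u', u != v', v != u' & v != v'] ->
  forall i j, i < n -> j < n ->
  axis_separated (q u v i, q u v i.+1) (q u' v' j, q u' v' j.+1).

Definition edge_segments u v := [seq (q u v i, q u v i.+1) | i <- iota 0 n].

Fixpoint walk_segments (x : G) (s : seq G) :=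
  if s is y :: s' then edge_segments x y ++ walk_segments y s' else [::].

Lemma segment_chain_walk x s : path (@adj G) x s ->
  segment_chain (walk_segments x s) (p x) (p (last x s)).
Proof.
elim: s x => [|y s IH] x /=; first by move=> _; exact: segment_chain_nil.
case/andP=> /q_ends[<- qy] ys; apply: segment_chain_cat (IH _ ys).
by rewrite -qy; apply: segment_chain_iota.
Qed.

Lemma walk_segmentsP x s f : path (@adj G) x s -> f \in walk_segments x s ->
  exists u v i, [/\ adj u v, u \in x :: s, v \in x :: s, i < n &
    f = (q u v i, q u v i.+1)].
Proof.
elim: s x => [|y s IH] x //= /andP[xy ys]; rewrite mem_cat => /orP[/mapP[i]|].
  rewrite mem_iota => /andP[_ i_n] ->; exists x, y, i.
  by rewrite !inE !eqxx orbT.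
case/(IH _ ys) => u [v [i [uv us vs i_n ->]]]; exists u, v, i.
by rewrite inE us orbT inE vs orbT.
Qed.

Lemma head_walk x s : path (@adj G) x s -> s != [::] ->
  exists2 f, f \in walk_segments x s & p x \in [:: f.1; f.2].
Proof.
case: s => //= y s /andP[/q_ends[<- _] _] _.
exists (q x y 0, q x y 1); last by rewrite inE eqxx.
by rewrite mem_cat map_f // mem_iota.
Qed.

Lemma last_walk x s : path (@adj G) x s -> s != [::] ->
  exists2 f, f \in walk_segments x s & p (last x s) \in [:: f.1; f.2].
Proof.
elim: s x => //= y [_|z s IH] x /andP[/q_ends[_ qy] ys] _.
  exists (q x y n.-1, q x y n); last by rewrite /= qy !inE eqxx orbT.
  rewrite mem_cat /edge_segments; apply/orP; left; apply/mapP.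
  by exists n.-1; rewrite ?mem_iota prednK // add0n leqnn.
by have [f fs pf] := IH y ys isT; exists f => //; rewrite mem_cat fs orbT.
Qed.

Lemma walks_parity x s y t :
    path (@adj G) x s -> path (@adj G) y t -> s != [::] -> t != [::] ->
    (forall z, z \in x :: s -> z \notin y :: t) ->
  (parity_above (p x) (walk_segments y t) (+)
   parity_above (p (last x s)) (walk_segments y t)) (+)
  (parity_above (p y) (walk_segments x s) (+)
   parity_above (p (last y t)) (walk_segments x s)) =
  (lexlt (p x) (p y) (+) lexlt (p (last x s)) (p y)) (+)
  (lexlt (p x) (p (last y t)) (+) lexlt (p (last x s)) (p (last y t))).
Proof.
move=> xs yt s0 t0 dis.
apply: chains_interleave; try exact: segment_chain_walk; last 2 first.
- exact: head_walk.
- exact: last_walk.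
move=> ? ? /(walk_segmentsP xs)[u [v [i [uv us vs i_n ->]]]].
move=> /(walk_segmentsP yt)[u' [v' [j [uv' us' vs' j_n ->]]]].
apply: q_sep => //; split.
- by apply: contraTneq us' => <-; apply: dis.
- by apply: contraTneq vs' => <-; apply: dis.
- by apply: contraTneq us' => <-; apply: dis.
- by apply: contraTneq vs' => <-; apply: dis.
Qed.

(** Choose a vertex [c i] in each branch set and, for each edge of the pattern [K], a walk inside
    its two branch sets. Disjoint pattern edges give vertex-disjoint walks, to which [walks_parity]
    applies. *)
Lemma minor_parity (m : nat) (K : rel nat) (A : nat -> {set G}) :
    (forall i, i < m -> (exists x, x \in A i) /\ connected_set (@adj G) (A i)) ->
    (forall i j, i < j < m -> [disjoint A i & A j]) ->
    (forall i j, i < m -> j < m -> K i j -> touching (@adj G) (A i) (A j)) ->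
  exists (o : rel nat) (u : nat -> nat -> nat -> bool),
  (forall i j, i < j < m -> o j i = ~~ o i j) /\
  (forall i j k l, all (ltn^~ m) [:: i; j; k; l] -> K i j -> K k l ->
    uniq [:: i; j; k; l] -> parity_sum o u i j k l = false).
Proof.
case: m => [|m] A_conn A_disj A_touch.
  by exists eq_op, (fun _ _ _ => false); split=> [i j|i j k l]; rewrite ?ltn0 ?andbF.
have disj i j : i < m.+1 -> j < m.+1 -> i != j -> [disjoint A i & A j].
  move=> im jm; rewrite neq_ltn => /orP[ij|ji].
    by apply: A_disj; rewrite ij.
  by rewrite disjoint_sym; apply: A_disj; rewrite ji.
have [[x0 _] _] := A_conn 0 isT.
have /choice[c cA] i : exists x, i < m.+1 -> x \in A i.
  case: (ltnP i m.+1) => [/A_conn[[x xA] _]|_]; last by exists x0.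
  by exists x.
have /choice[w wP] (ij : nat * nat) : exists s,
    ij.1 < m.+1 -> ij.2 < m.+1 -> K ij.1 ij.2 ->
    [/\ path (@adj G) (c ij.1) s, last (c ij.1) s = c ij.2, s != [::] &
      {subset c ij.1 :: s <= A ij.1 :|: A ij.2}].
  case: ij => i j /=; case: (ltnP i m.+1) => [im|]; last by exists [::].
  case: (ltnP j m.+1) => [jm|]; last by exists [::].
  case: (boolP (K i j)) => [Kij|]; last by exists [::].
  have [s sP] := touching_walk (A_conn _ im).2 (A_conn _ jm).2
    (A_touch _ _ im jm Kij) (cA _ im) (cA _ jm).
  by exists s.
exists (fun i j => lexlt (p (c i)) (p (c j))).
exists (fun k i j => parity_above (p (c k)) (walk_segments (c i) (w (i, j)))).
split=> [i j /andP[ij jm]|i j k l].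
  have im := ltn_trans ij jm; apply: lexltN; apply/negP => /eqP/p_inj cij.
  have /pred0P/(_ (c i)) := disj _ _ im jm (negbT (ltn_eqF ij)).
  by rewrite /= {2}cij !cA.
case/and5P=> im jm km lm _ Kij Kkl /=; rewrite !inE !negb_or andbT.
case/and3P=> /and3P[_ ik il] /andP[jk jl] _.
have [cs cj s0 sA] := wP (i, j) im jm Kij.
have [cs' cl s'0 sA'] := wP (k, l) km lm Kkl.
have := walks_parity cs cs' s0 s'0; rewrite /parity_sum cj cl => ->.
  by rewrite addbb.
move=> z /sA zij; apply: contraTN zij => /sA'; rewrite !inE => /orP zkl.
have notin i' j' : i' < m.+1 -> j' < m.+1 -> i' != j' -> z \in A j' ->
    z \notin A i'.
  by move=> i'm j'm ij' zj; rewrite (disjointFl (disj _ _ i'm j'm ij') zj).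
by rewrite negb_or; case: zkl => zk; apply/andP; split;
  [apply: notin zk | apply: notin zk | apply: notin zk | apply: notin zk].
Qed.

End Sampled.

Lemma planar_K5_free (R : realType) (G : sgraph) :
  planar R G -> K5_free (@adj G).
Proof.
case/planar_sampling => p [n [q [p_inj n0 q_ends q_sep]]] A A_conn A_disj A_touch.
have [i j _ _ ij|o [u [oN uP]]] := minor_parity (K := fun i j => i < j < 5)
  p_inj n0 q_ends q_sep A_conn A_disj.
  exact: A_touch.
apply: (K5_parity oN) => i j k l ij kl; apply: uP => //=.
case/andP: (ij) => i_j j5; case/andP: (kl) => k_l l5.
by rewrite j5 l5 (ltn_trans i_j j5) (ltn_trans k_l l5).
Qed.

Lemma planar_K33_free (R : realType) (G : sgraph) :
  planar R G -> K33_free (@adj G).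
Proof.
case/planar_sampling => p [n [q [p_inj n0 q_ends q_sep]]] A A_conn A_disj A_touch.
have [i j _ j6 ij|o [u [oN uP]]] := minor_parity (K := fun i j => i < 3 <= j)
  p_inj n0 q_ends q_sep A_conn A_disj.
  exact: A_touch.
apply: (K33_parity oN) => i j k l ij kl; rewrite gtn_max => /andP[j6 l6].
apply: uP => //=; case/andP: (ij) => i3 _; case/andP: (kl) => k3 _.
by rewrite j6 l6 !(leq_trans _ (isT : 3 <= 6)).
Qed.

(** * From arbitrary lists to finite ones *)

Local Open Scope classical_set_scope.
Local Open Scope card_scope.

Lemma card_le_injective (T : Type) (A : set T) n :
  `I_n #<= A <-> exists2 h : 'I_n -> T, injective h & forall i, A (h i).
Proof.
split=> [/card_leP[f]|[h h_inj hA]].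
  have iP (i : 'I_n) : nat_of_ord i \in `I_n by apply/mem_set/ltn_ord.
  exists (fun i => \val (f (exist (fun k => k \in `I_n) _ (iP i)))) => [i j /val_inj|i].
    by move/(inj (mem_set I) (mem_set I)) => [] /val_inj.
  exact/set_mem/valP.
have I_T : `I_n #= [set: 'I_n].
  have <- : @nat_of_ord n @` [set: 'I_n] = `I_n.
    apply/seteqP; split=> [_ [i _ <-]|i i_n] /=; first exact: ltn_ord.
    by exists (Ordinal i_n).
  by apply: inj_card_eq => i j _ _; apply: val_inj.
rewrite (card_le_eql I_T) -(card_le_eql (inj_card_eq (f := h) _)); last first.
  by move=> i j _ _; apply: h_inj.
by apply: subset_card_le => _ [i _ <-].
Qed.

Lemma card_le_finset (K : finType) (T : Type) (S : {set K}) (h : K -> T) (A : set T) :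
  {in S &, injective h} -> {in S, forall k, A (h k)} -> `I_#|S| #<= A.
Proof.
move=> h_inj hA; apply/card_le_injective; exists (fun i => h (enum_val i)).
  by move=> i j /h_inj; rewrite !enum_valP => /(_ isT isT)/enum_val_inj.
by move=> i; apply/hA/enum_valP.
Qed.

Theorem theorem1p4 (R : realType) (G : sgraph) (C : Type) (L : G -> set C)
    (hG : planar R G) (hL : lk_list_assignment 4 2 L)
    (hT : forall x y z : G, ~ offensive_triangle L x y z) :
  list_colourable L.
Proof.
case: hL => L4 L2.
have /choice[h hP] v : exists h : 'I_4 -> C, injective h /\ forall i, L v (h i).
  by have /card_le_injective[h] := L4 v; exists h.
(* Pairs in [G * 'I_4] are names for the four chosen colours of each vertex. One colour may have
   several names, so [rep] selects a canonical one; equality of colours becomes equality in a finite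
   type. *)
pose col (x : G * 'I_4) := h x.1 x.2.
pose rep x := odflt x [pick y | `[< col y = col x >]].
have repE x : col (rep x) = col x.
  by rewrite /rep; case: pickP => [y /asboolP|].
have rep_eq x y : col x = col y -> rep x = rep y.
  rewrite /rep => xy; rewrite (eq_pick (Q := fun z => `[< col z = col y >])).
    by case: pickP => // /(_ y)/asboolP.
  by move=> z; rewrite xy.
pose L' v := [set rep (v, i) | i : 'I_4]%SET.
have col_inj : {in [pred x | rep x == x] &, injective col}.
  by move=> x y /eqP xE /eqP yE /rep_eq; rewrite xE yE.
have L'P v x : x \in L' v -> rep x = x /\ L v (col x).
  move=> /imsetP[i _ ->]; split; first by apply: rep_eq; rewrite repE.
  by rewrite repE; exact: (hP v).2.
have inj' (S : {set G * 'I_4}) v : S \subset L' v -> {in S &, injective col}.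
  move=> /fintype.subsetP SL x y /SL/L'P[xE _] /SL/L'P[yE _]; apply: col_inj.
    by rewrite inE xE.
  by rewrite inE yE.
have L'2 x y : adj x y -> (#|L' x :&: L' y| <= 2)%N.
  move=> xy; rewrite -card_le_II; apply: card_le_trans (L2 x y xy).
  apply: (card_le_finset (h := col)); first by apply: (inj' _ x); apply: finset.subsetIl.
  by move=> k; rewrite inE => /andP[/L'P[_ ?] /L'P[_ ?]].
(* A vertex is needed to have a default colour, so the empty graph is treated apart. *)
have [G0|[v0 _]] := set_0Vmem [set: G]%SET.
  have noG (v : G) : False by have := finset.in_setT v; rewrite G0 finset.in_set0.
  by exists (fun v => False_rect C (noG v)); split=> v; case: (noG v).
have [] := @minor_free_colourable G (@adj G) (@adj_sym G) (@adj_irrefl G) _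
  (v0, ord0) L' (planar_K5_free hG) (planar_K33_free hG).
- move=> v; rewrite card_imset ?card_ord // => i j /(congr1 col).
  by rewrite !repE; apply: (hP v).1.
- exact: L'2.
(* Two common colours in the shrunken lists are also common in the original ones, where the edge
   condition allows at most two; the triangle would be offensive. *)
- move=> x y z xy yz xz; rewrite leqNgt; apply/negP => gt1.
  apply: (hT x y z); split; first by split.
  rewrite card_eq_le; apply/andP; split.
    by apply: card_le_trans (L2 x y xy); apply: subset_card_le => k [].
  have := card_le_II 2 #|L' x :&: L' y :&: L' z|; rewrite gt1 => /card_le_trans; apply.
  apply: (card_le_finset (h := col)).
    by apply: (inj' _ x); rewrite -finset.setIA; apply: finset.subsetIl.
  by move=> k; rewrite !inE => /andP[/andP[/L'P[_ ?] /L'P[_ ?]] /L'P[_ ?]].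
move=> phi [phiL phiP]; exists (fun v => col (phi v)); split=> [u v uv|v].
  have [uE _] := L'P _ _ (phiL u (finset.in_setT u)).
  have [vE _] := L'P _ _ (phiL v (finset.in_setT v)).
  move/col_inj; rewrite !inE uE vE !eqxx => /(_ isT isT)/eqP.
  by apply/negP/phiP; rewrite ?finset.in_setT.
by have [] := L'P _ _ (phiL v (finset.in_setT v)).
Qed.
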